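(* Let $m\ge2$, and let $X$ and $U^1,\dots,U^m$ be convex sets, each equipped with a proximal setup: $X$ with norm $\|\cdot\|_X$, distance-generating function $\omega_X$ and set width $\Omega_X\in(0,\infty)$; $U^i$ with norm $\|\cdot\|_{(i)}$, distance-generating function $\omega^i$ and set width at most $\Omega_U<\infty$. For $i\in[m]$ let $f^i:X\times U^i\to\mathbb{R}$ be convex in $x$ and concave in $u^i$, with $\|\nabla_xf^i(x,u^i)\|_{X,*}\le G_X$ and $\|\nabla_uf^i(x,u^i)\|_{(i),*}\le G_U<\infty$ for all $x\in X,u^i\in U^i$, where $G_X\in(0,\infty)$. Suppose that for each $i\in[m]$ there is $\alpha_U^i>0$ such that $-f^i(x,u^i)-\alpha_U^i\omega^i(u^i)$ is convex in $u^i$ for every fixed $x\in X$, and set $\alpha_U=\min_i\alpha_U^i$. Suppose also that there is $L_X<\infty$ with $\|\nabla_xf^i(x,u^i)-\nabla_xf^i(x',u^i)\|_{X,*}\le L_X\|x-x'\|_X$ for all $i\in[m]$, $u^i\in U^i$, $x,x'\in X$. Then for every $\epsilon>0$ the $\epsilon$-robust feasibility problem is solved (in the sense of the decision rule given in the context, for any fixed $\tau\in(0,1)$) within $T=O(\sqrt{\log(m)}/\epsilon)$ iterations, the hidden constant being independent of $\epsilon$ and $m$, using the weights $\theta_t=\frac{2t}{T(T+1)}$ and the following iterations. Let $Y=\Delta_m$, let $X\times Y$ carry the joint proximal setup of the context, and let $L_{X,Y}=L_X\Omega_X+2G_X\sqrt{\Omega_X\log(m)}$. Let $u_1^i$ be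 the $\omega^i$-center of $U^i$ and for $t\ge1$ $$u_{t+1}^i=\mathrm{Prox}^{U^i}_{u_t^i}\!\left(-\tfrac{2}{\alpha_U(t+1)}\nabla_uf^i(x_t,u_t^i)\right)\quad(i\in[m]).$$ With $\phi_t(x,y)=\sum_{i=1}^my^{(i)}f^i(x,u_t^i)$ and $F_t(x,y)=[\nabla_x\phi_t(x,y);-\nabla_y\phi_t(x,y)]$, let $v_1$ be the center of $X\times Y$ for the joint setup, and for $t\ge1$ $$[x_t;y_t]=\mathrm{Prox}^{X\times Y}_{v_t}(\gamma\theta_tF_t(v_t)),\qquad v_{t+1}=\mathrm{Prox}^{X\times Y}_{v_t}(\gamma\theta_tF_t(x_t,y_t)),\qquad\gamma=\frac{1}{L_{X,Y}\sup_{s\in[T]}\theta_s}.$$ Here $u_t$ is computed with knowledge of $x_{t-1},u_{t-1}$, while $[x_t;y_t]$ is computed with the knowledge of $u_{t-1},u_t$ and $[x_{t-1};y_{t-1}]$.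
   Context: $[m]=\{1,\dots,m\}$; $u_t=[u_t^1;\dots;u_t^m]$; $\Delta_m=\{y\in\mathbb{R}^m_+:\sum_iy^{(i)}=1\}$. $\epsilon$-robust feasibility problem: either find $x\in X$ with $\sup_{u^i\in U^i}f^i(x,u^i)\le\epsilon$ for all $i\in[m]$, or correctly declare infeasibility, i.e. that for every $x\in X$ there is $i\in[m]$ with $\sup_{u^i\in U^i}f^i(x,u^i)>0$. Decision rule: after $T$ iterations with weights $\theta$, if $\max_{i\in[m]}\sum_{t=1}^T\theta_tf^i(x_t,u_t^i)\le(1-\tau)\epsilon$, output $\bar x_T=\sum_{t=1}^T\theta_tx_t$ as an $\epsilon$-feasible point; otherwise declare infeasibility. ''Solved'' means that whichever of the two outputs is produced is correct. $\nabla_xf^i$ is a (selected) subgradient of $f^i(\cdot,u^i)$; $\nabla_uf^i$ a (selected) supergradient of the concave function $f^i(x,\cdot)$; $\nabla_x\phi_t(x,y)=\sum_iy^{(i)}\nabla_xf^i(x,u_t^i)$ and $\nabla_y\phi_t(x,y)=(f^i(x,u_t^i))_{i\in[m]}$. A subscript $*$ on a norm denotes the dual norm. Proximal setup for a convex domain $Z$ in a Euclidean space $E$: (i) a norm $\|\cdot\|$ on $E$ with dual norm $\|\zeta\|_*=\max_{\|z\|\le 1}\langle\zeta,z\rangle$; (ii) a distance-generating function $\omega:Z\to\mathbb{R}$, convex and continuous on $Z$, admitting a selection of subgradients $\nabla\omega(z)$ that is continuous on $Z^\circ:=\{z\in Z:\partial\omega(z)\ne\emptyset\}$, and strongly convex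 with modulus 1: $\langle\nabla\omega(z')-\nabla\omega(z''),z'-z''\rangle\ge\|z'-z''\|^2$ for all $z',z''\in Z^\circ$; (iii) Bregman distance $V_z(z'):=\omega(z')-\omega(z)-\langle\nabla\omega(z),z'-z\rangle$ for $z\in Z^\circ$, $z'\in Z$; (iv) prox-mapping $\mathrm{Prox}^Z_z(\xi):=\arg\min_{z'\in Z}\{\langle\xi,z'\rangle+V_z(z')\}$, a map $E\to Z^\circ$, for $z\in Z^\circ$; (v) $\omega$-center $z_\omega:=\arg\min_{z\in Z}\omega(z)$; (vi) set width $\Omega:=\max_{z\in Z}V_{z_\omega}(z)$. Existence of these minimizers and of the maximum is part of the setup. Joint proximal setup on $X\times Y$, $Y=\Delta_m$: equip $Y$ with the $\ell_1$-norm and negative entropy $\omega_Y(y)=\sum_iy^{(i)}\log y^{(i)}$, of set width $\log(m)$. Put $\sigma_X=(L_X\Omega_X+G_X\sqrt{\Omega_X\log m})/L_{X,Y}$, $\sigma_Y=G_X\sqrt{\Omega_X\log m}/L_{X,Y}$, $\beta_X=\sigma_X/\Omega_X$, $\beta_Y=\sigma_Y/\log m$. The joint distance-generating function is $\beta_X\omega_X(x)+\beta_Y\omega_Y(y)$ and the joint norm is $\|[x;y]\|=\sqrt{\beta_X\|x\|_X^2+\beta_Y\|y\|_1^2}$; its set width is $\Omega_{X,Y}=1$, and $L_{X,Y}$ is the Lipschitz constant of the operators $F_t$ in this norm. *)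

(* Defs.v *)
From HB Require Import structures.
From mathcomp Require Import all_boot all_order all_algebra.
From mathcomp Require Import all_classical all_reals all_analysis.

Set Implicit Arguments.
Unset Strict Implicit.
Unset Printing Implicit Defensive.

Import Order.TTheory GRing.Theory Num.Theory.
Import numFieldNormedType.Exports.

Local Open Scope classical_set_scope.
Local Open Scope ring_scope.

(* Euclidean spaces are
   the spaces ['rV[R]_n] with their standard inner product.  The norms of
   proximal setups are explicit functions, unrelated to the canonical sup norm
   of ['rV[R]_n]; the latter is only used for its topology. *)

Definition dotp (R : realType) (n : nat) (u v : 'rV[R]_n) : R :=
  (u *m v^T) 0 0.

Record is_norm (R : realType) (n : nat) (N : 'rV[R]_n -> R) : Prop := IsNorm {
  is_norm_triangle : forall u v, N (u + v) <= N u + N v ;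
  is_norm_scale : forall (a : R) u, N (a *: u) = `|a| * N u ;
  is_norm_eq0 : forall u, N u = 0 -> u = 0 }.

Definition dual_norm (R : realType) (n : nat) (N : 'rV[R]_n -> R)
    (zeta : 'rV[R]_n) : R :=
  sup [set dotp zeta z | z in [set z | N z <= 1]].

Definition is_argmin (R : realType) (n : nat) (Z : set 'rV[R]_n)
    (h : 'rV[R]_n -> R) (z : 'rV[R]_n) : Prop :=
  Z z /\ forall z', Z z' -> h z <= h z'.

(* Subgradients are relative to the domain [Z]: only the values of [h] on [Z]
   matter. *)
Definition is_subgradient (R : realType) (n : nat) (Z : set 'rV[R]_n)
    (h : 'rV[R]_n -> R) (z g : 'rV[R]_n) : Prop :=
  forall z', Z z' -> h z + dotp g (z' - z) <= h z'.

Definition is_supergradient (R : realType) (n : nat) (Z : set 'rV[R]_n)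
    (h : 'rV[R]_n -> R) (z g : 'rV[R]_n) : Prop :=
  forall z', Z z' -> h z' <= h z + dotp g (z' - z).

Record prox_data (R : realType) (n : nat) := ProxData {
  pdom : set 'rV[R]_n ;
  pnorm : 'rV[R]_n -> R ;
  dgf : 'rV[R]_n -> R ;
  dgf_grad : 'rV[R]_n -> 'rV[R]_n }.

(* The set of points of the domain at which the distance-generating function
   has a subgradient. *)
Definition pdomo (R : realType) (n : nat) (P : prox_data R n) : set 'rV[R]_n :=
  [set z | pdom P z /\ exists g, is_subgradient (pdom P) (dgf P) z g].

Definition bregman (R : realType) (n : nat) (P : prox_data R n)
    (z z' : 'rV[R]_n) : R :=
  dgf P z' - dgf P z - dotp (dgf_grad P z) (z' - z).

(* [is_prox P z xi z'] : z' = Prox_z(xi). *)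
Definition is_prox (R : realType) (n : nat) (P : prox_data R n)
    (z xi : 'rV[R]_n) : 'rV[R]_n -> Prop :=
  is_argmin (pdom P) (fun z' => dotp xi z' + bregman P z z').

Definition is_center (R : realType) (n : nat) (P : prox_data R n) :
    'rV[R]_n -> Prop :=
  is_argmin (pdom P) (dgf P).

Definition is_width (R : realType) (n : nat) (P : prox_data R n) (Om : R) :
    Prop :=
  exists zc, [/\ is_center P zc,
    forall z, pdom P z -> bregman P zc z <= Om &
    exists2 z, pdom P z & bregman P zc z = Om].

Record proximal_setup (R : realType) (n : nat) (P : prox_data R n) : Prop :=
  ProximalSetup {
  setup_convex : convex_set (pdom P) ;
  setup_norm : is_norm (pnorm P) ;
  setup_dgf_convex : convex_function (pdom P) (dgf P) ;
  setup_dgf_continuous : {within pdom P, continuous (dgf P)} ;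
  setup_grad : forall z, pdomo P z ->
    is_subgradient (pdom P) (dgf P) z (dgf_grad P z) ;
  setup_grad_continuous : {within pdomo P, continuous (dgf_grad P)} ;
  setup_strong : forall z' z'', pdomo P z' -> pdomo P z'' ->
    pnorm P (z' - z'') ^+ 2 <=
      dotp (dgf_grad P z' - dgf_grad P z'') (z' - z'') ;
  setup_center : exists z, is_center P z ;
  setup_prox : forall z xi, pdomo P z ->
    exists2 z', pdomo P z' & is_prox P z xi z' ;
  setup_width : exists Om, is_width P Om }.

(* The simplex with the l1 norm and the negative entropy.  [0 * ln 0 = 0]
   because [ln 0 = 0]; the gradient is only meaningful at points with positive
   coordinates, which are exactly the points with a subgradient. *)
Definition simplex_data (R : realType) (m : nat) : prox_data R m :=
  {| pdom := [set y | (forall i, 0 <= y 0 i) /\ \sum_i y 0 i = 1] ;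
     pnorm := fun y => \sum_i `|y 0 i| ;
     dgf := fun y => \sum_i y 0 i * ln (y 0 i) ;
     dgf_grad := fun y => \row_i (ln (y 0 i) + 1) |}.

(* [x; y] is encoded as [row_mx x y], so that [dotp] on ['rV_(n + m)] is the
   sum of the two inner products. *)
Definition joint_data (R : realType) (n m : nat) (bX bY : R)
    (PX : prox_data R n) (PY : prox_data R m) : prox_data R (n + m) :=
  {| pdom := [set v | pdom PX (lsubmx v) /\ pdom PY (rsubmx v)] ;
     pnorm := fun v => Num.sqrt (bX * pnorm PX (lsubmx v) ^+ 2
                                 + bY * pnorm PY (rsubmx v) ^+ 2) ;
     dgf := fun v => bX * dgf PX (lsubmx v) + bY * dgf PY (rsubmx v) ;
     dgf_grad := fun v => row_mx (bX *: dgf_grad PX (lsubmx v))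
                                 (bY *: dgf_grad PY (rsubmx v)) |}.

Definition LXY (R : realType) (OmX GX LX : R) (m : nat) : R :=
  LX * OmX + 2 * GX * Num.sqrt (OmX * ln m%:R).

Definition sigmaX (R : realType) (OmX GX LX : R) (m : nat) : R :=
  (LX * OmX + GX * Num.sqrt (OmX * ln m%:R)) / LXY OmX GX LX m.

Definition sigmaY (R : realType) (OmX GX LX : R) (m : nat) : R :=
  GX * Num.sqrt (OmX * ln m%:R) / LXY OmX GX LX m.

Definition joint_setup (R : realType) (n : nat) (OmX GX LX : R) (m : nat)
    (PX : prox_data R n) : prox_data R (n + m) :=
  joint_data (sigmaX OmX GX LX m / OmX) (sigmaY OmX GX LX m / ln m%:R)
             PX (simplex_data R m).

Definition theta (R : realType) (T t : nat) : R :=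
  (2 * t)%:R / (T * T.+1)%:R.

Definition gammaT (R : realType) (OmX GX LX : R) (m T : nat) : R :=
  (LXY OmX GX LX m
   * sup [set theta R T s | s in [set s : nat | (1 <= s <= T)%N]])^-1.

(* F(x, y) = [grad_x phi(x, y); - grad_y phi(x, y)] for
   phi(x, y) = \sum_i y_i f^i(x, u^i). *)
Definition Fop (R : realType) (n m : nat) (k : 'I_m -> nat)
    (f : forall i : 'I_m, 'rV[R]_n -> 'rV[R]_(k i) -> R)
    (gx : forall i : 'I_m, 'rV[R]_n -> 'rV[R]_(k i) -> 'rV[R]_n)
    (u : forall i : 'I_m, 'rV[R]_(k i)) (v : 'rV[R]_(n + m)) :
    'rV[R]_(n + m) :=
  row_mx (\sum_i rsubmx v 0 i *: gx i (lsubmx v) (u i))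
         (- \row_i f i (lsubmx v) (u i)).

(* The first T iterations; sequences are indexed from 1, their terms of index 0
   play no role, and [z t] is [x_t; y_t]. *)
Record iterations (R : realType) (n m : nat) (k : 'I_m -> nat)
    (OmX GX LX alphaU : R)
    (PX : prox_data R n) (PU : forall i : 'I_m, prox_data R (k i))
    (f : forall i : 'I_m, 'rV[R]_n -> 'rV[R]_(k i) -> R)
    (gx : forall i : 'I_m, 'rV[R]_n -> 'rV[R]_(k i) -> 'rV[R]_n)
    (gu : forall i : 'I_m, 'rV[R]_n -> 'rV[R]_(k i) -> 'rV[R]_(k i))
    (T : nat) (u : nat -> forall i : 'I_m, 'rV[R]_(k i))
    (v z : nat -> 'rV[R]_(n + m)) : Prop := Iterations {
  iter_u1 : forall i, is_center (PU i) (u 1%N i) ;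
  iter_u : forall t i, (1 <= t <= T)%N ->
    is_prox (PU i) (u t i)
      (- (2 / (alphaU * (t.+1)%:R)) *: gu i (lsubmx (z t)) (u t i))
      (u t.+1 i) ;
  iter_v1 : is_center (joint_setup OmX GX LX m PX) (v 1%N) ;
  iter_z : forall t, (1 <= t <= T)%N ->
    is_prox (joint_setup OmX GX LX m PX) (v t)
      ((gammaT OmX GX LX m T * theta R T t) *: Fop f gx (u t) (v t)) (z t) ;
  iter_v : forall t, (1 <= t <= T)%N ->
    is_prox (joint_setup OmX GX LX m PX) (v t)
      ((gammaT OmX GX LX m T * theta R T t) *: Fop f gx (u t) (z t))
      (v t.+1) }.

Definition robust_feasible (R : realType) (n m : nat) (k : 'I_m -> nat)
    (X : set 'rV[R]_n) (U : forall i : 'I_m, set 'rV[R]_(k i))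
    (f : forall i : 'I_m, 'rV[R]_n -> 'rV[R]_(k i) -> R)
    (eps : R) (x : 'rV[R]_n) : Prop :=
  X x /\ forall i, (ereal_sup [set (f i x ui)%:E | ui in U i] <= eps%:E)%E.

Definition robust_infeasible (R : realType) (n m : nat) (k : 'I_m -> nat)
    (X : set 'rV[R]_n) (U : forall i : 'I_m, set 'rV[R]_(k i))
    (f : forall i : 'I_m, 'rV[R]_n -> 'rV[R]_(k i) -> R) : Prop :=
  forall x, X x ->
    exists i, (0%:E < ereal_sup [set (f i x ui)%:E | ui in U i])%E.

(* The output of the decision rule after T iterations is correct.  The [sup] is
   over the nonempty finite set of indices i, i.e. a maximum. *)
Definition decision_correct (R : realType) (n m : nat) (k : 'I_m -> nat)
    (X : set 'rV[R]_n) (U : forall i : 'I_m, set 'rV[R]_(k i))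
    (f : forall i : 'I_m, 'rV[R]_n -> 'rV[R]_(k i) -> R)
    (tau eps : R) (T : nat) (x : nat -> 'rV[R]_n)
    (u : nat -> forall i : 'I_m, 'rV[R]_(k i)) : Prop :=
  if sup (range (fun i : 'I_m =>
       \sum_(1 <= t < T.+1) theta R T t * f i (x t) (u t i)))
     <= (1 - tau) * eps
  then robust_feasible X U f eps (\sum_(1 <= t < T.+1) theta R T t *: x t)
  else robust_infeasible X U f.

(* Main.v *)
Require Import Defs.
From HB Require Import structures.
From mathcomp Require Import all_boot all_order all_algebra.
From mathcomp Require Import all_classical all_reals all_analysis.
From mathcomp Require Import ring lra.

(** Both answers of the decision rule are justified by regret bounds of order
    1/T for the weights theta_t.

    The uncertainty players.  Since f^i(x_t, .) is strongly concave relative to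
    the distance-generating function, its supergradient inequality gains a
    term: f^i(x_t, w) - f^i(x_t, u_t) <= <g_t, w - u_t> - alpha V_{u_t}(w).
    With the step 2 / (alpha (t + 1)), t times the prox inequality has the
    Bregman part alpha/2 ((t-1) t V_{u_t}(w) - t (t+1) V_{u_{t+1}}(w)), which
    telescopes with linearly growing weights and leaves only GU^2 / alpha per
    step.  Hence the regret is at most 2 GU^2 / (alpha (T + 1))
    ([strongly_concave_regret]).

    The pair (x, y).  It plays mirror-prox on the saddle functions phi_t.  The
    weights of the joint setup are such that Young's inequality distributes the
    cross terms of F_t exactly, which bounds the variation of F_t with constant
    L_XY in the joint norm ([Fop_smooth]); every step then telescopes
    ([mirror_prox_step]), the joint setup has width 1, and the duality gap is
    at most L_XY sup theta = 2 L_XY / (T + 1) ([saddle_gap]).  As m >= 2, L_XY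
    is O(sqrt (ln m)) ([LXY_le_sqrt_ln]).

    For T >= C sqrt (ln m) / eps the regret is at most tau eps and the gap at
    most (1 - tau) eps.  If the averaged payoffs are at most (1 - tau) eps,
    Jensen's inequality in x and the regret bound give f^i(xbar, w) <= eps.
    Otherwise some averaged payoff exceeds the gap, so that for every x in X
    the average of sum_j y_t^j f^j(x, u_t^j) is positive, and so is one of the
    values f^j(x, u_t^j).

    The proximal machinery needs care, because a domain may be neither closed
    nor full-dimensional and the chosen gradient is tied to the
    distance-generating function only by continuity on the set of points with
    a subgradient.  The key is that among all subgradients at a point the
    chosen one is the largest in every direction into the domain
    ([subgradient_sum_rule]).  It is proved along segments ending in the
    relative interior, where subgradients exist ([core_subgradient]), and
    extended to the whole domain by convexity.  The optimality condition of
    the prox-mapping and the inequality for strongly concave functions follow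
    from it; the quadratic lower bound of the Bregman distance is obtained by
    the same passage through the relative interior. *)

Set Implicit Arguments.
Unset Strict Implicit.
Unset Printing Implicit Defensive.

Import Order.TTheory GRing.Theory Num.Theory.
Import numFieldNormedType.Exports.

Local Open Scope classical_set_scope.
Local Open Scope ring_scope.

(** * Inner products and small-parameter limits *)
Section Dotp.
Context {R : realType} {n : nat}.
Implicit Types u v w : 'rV[R]_n.

Lemma dotpE u v : dotp u v = \sum_i u 0 i * v 0 i.
Proof. by rewrite /dotp mxE; apply: eq_bigr => i _; rewrite mxE. Qed.

Lemma dotpDl u v w : dotp (u + v) w = dotp u w + dotp v w.
Proof. by rewrite /dotp mulmxDl mxE. Qed.

Lemma dotpDr u v w : dotp u (v + w) = dotp u v + dotp u w.
Proof. by rewrite /dotp linearD mulmxDr mxE. Qed.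

Lemma dotpNl u v : dotp (- u) v = - dotp u v.
Proof. by rewrite /dotp mulNmx mxE. Qed.

Lemma dotpNr u v : dotp u (- v) = - dotp u v.
Proof. by rewrite /dotp linearN mulmxN mxE. Qed.

Lemma dotpBl u v w : dotp (u - v) w = dotp u w - dotp v w.
Proof. by rewrite dotpDl dotpNl. Qed.

Lemma dotpBr u v w : dotp u (v - w) = dotp u v - dotp u w.
Proof. by rewrite dotpDr dotpNr. Qed.

Lemma dotpZl a u v : dotp (a *: u) v = a * dotp u v.
Proof. by rewrite /dotp -scalemxAl mxE. Qed.

Lemma dotpZr a u v : dotp u (a *: v) = a * dotp u v.
Proof. by rewrite /dotp linearZ -scalemxAr mxE. Qed.

Lemma dotp0l v : dotp 0 v = 0.
Proof. by rewrite /dotp mul0mx mxE. Qed.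

Lemma dotp0r v : dotp v 0 = 0.
Proof. by rewrite /dotp linear0 mulmx0 mxE. Qed.

Lemma dotp_suml I (r : seq I) (F : I -> 'rV[R]_n) v :
  dotp (\sum_(i <- r) F i) v = \sum_(i <- r) dotp (F i) v.
Proof. by rewrite /dotp mulmx_suml summxE. Qed.

Lemma coord_le_norm u i : `|u 0 i| <= `|u|.
Proof.
by rewrite [leRHS]/Num.norm/= mx_normrE; apply/bigmax_geP; right; exists (0, i).
Qed.

Lemma dotp_le_supnorm u v : dotp u v <= `|u| * \sum_i `|v 0 i|.
Proof.
rewrite dotpE mulr_sumr; apply: ler_sum => i _; apply: le_trans (ler_norm _) _.
by rewrite normrM ler_wpM2r// coord_le_norm.
Qed.

Lemma dotpC u v : dotp u v = dotp v u.
Proof. by rewrite !dotpE; apply: eq_bigr => i _; rewrite mulrC. Qed.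

(** Expands inner products into their values on atomic vectors, after which
    inequalities between them are linear arithmetic. *)
Definition dotp_lin := (dotpBl, dotpBr, dotpDl, dotpDr, dotpNl, dotpNr,
  dotpZl, dotpZr, dotp0l, dotp0r).

End Dotp.

Lemma dotp_row_mx (R : realType) (n m : nat) (u v : 'rV[R]_(n + m)) :
  dotp u v = dotp (lsubmx u) (lsubmx v) + dotp (rsubmx u) (rsubmx v).
Proof.
rewrite !dotpE big_split_ord /=; congr (_ + _);
  by apply: eq_bigr => i _; rewrite !mxE.
Qed.

Lemma lsubmxB (R : realType) (n m : nat) (u v : 'rV[R]_(n + m)) :
  lsubmx (u - v) = lsubmx u - lsubmx v.
Proof. exact: linearB. Qed.

Lemma rsubmxB (R : realType) (n m : nat) (u v : 'rV[R]_(n + m)) :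
  rsubmx (u - v) = rsubmx u - rsubmx v.
Proof. exact: linearB. Qed.

Lemma le0_of_small (R : realType) (a b : R) :
  (forall s, 0 < s < 1 -> a <= s * b) -> a <= 0.
Proof.
move=> h; rewrite leNgt; apply/negP => a0.
have b0 : 0 < `|b| + 1 by rewrite ltr_wpDl.
pose s := Num.min (1 / 2) (a / (2 * (`|b| + 1))).
have s0 : 0 < s by rewrite lt_min divr_gt0 ?mulr_gt0//= divr_gt0.
have s1 : s < 1 by rewrite gt_min; apply/orP; left; lra.
have /h : 0 < s < 1 by rewrite s0 s1.
have : s * b <= s * (`|b| + 1).
  by rewrite ler_pM2l// (le_trans (ler_norm _))// lerDl.
have : s * (`|b| + 1) <= a / 2.
  rewrite -ler_pdivlMr// (_ : a / 2 / _ = a / (2 * (`|b| + 1))).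
    by rewrite ge_min lexx orbT.
  by field; rewrite gt_eqF.
lra.
Qed.

(** * Relative interiors and subgradients of convex functions *)
Section Convexity.
Context {R : realType} {n : nat}.
Implicit Types (Z : set 'rV[R]_n) (h : 'rV[R]_n -> R) (w p d : 'rV[R]_n).

Lemma convex_set_seg Z a b (s : R) : convex_set Z -> Z a -> Z b -> 0 <= s <= 1 ->
  Z (a + s *: (b - a)).
Proof.
move=> cZ Za Zb /andP[s0 s1].
have /set_mem := cZ b a (Itv01 s0 s1) (mem_set Zb) (mem_set Za).
congr Z; rewrite /conv/= /unstable.onem/=; apply/rowP => i; rewrite !mxE; ring.
Qed.

Lemma convex_function_seg Z h a b (s : R) : convex_function Z h ->
  Z a -> Z b -> 0 <= s <= 1 ->
  h (a + s *: (b - a)) <= h a + s * (h b - h a).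
Proof.
move=> ch Za Zb /andP[s0 s1].
have := ch (Itv01 s0 s1) b a (mem_set Zb) (mem_set Za).
rewrite /conv/= /unstable.onem/= /GRing.scale/=.
rewrite (_ : s *: b + _ = a + s *: (b - a)); last first.
  by apply/rowP => i; rewrite !mxE; ring.
suff <- : s * h b + (1 - s) * h a = h a + s * (h b - h a) by [].
ring.
Qed.

(** For convex [Z] these directions form a linear subspace. *)
Definition bidir Z w d : Prop :=
  exists2 e : R, 0 < e & forall s : R, `|s| <= e -> Z (w + s *: d).

(** The relative interior of a convex set, in an algebraic form: every segment
    from a point of [Z] to [w] can be prolonged beyond [w]. *)
Definition core Z w : Prop := Z w /\ forall z, Z z -> bidir Z w (z - w).

Lemma bidir0 Z w : Z w -> bidir Z w 0.
Proof. by move=> Zw; exists 1 => // s _; rewrite scaler0 addr0. Qed.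

Lemma bidirD Z w d d' : convex_set Z ->
  bidir Z w d -> bidir Z w d' -> bidir Z w (d + d').
Proof.
move=> cZ [e e0 he] [e' e'0 he']; exists (Num.min e e' / 2).
  by rewrite divr_gt0// lt_min e0.
move=> s; rewrite ler_pdivlMr// mulrC le_min => /andP[se se'].
have s2 : `|2 * s| = 2 * `|s| by rewrite normrM ger0_norm.
have Zd : Z (w + (2 * s) *: d) by apply: he; rewrite s2.
have Zd' : Z (w + (2 * s) *: d') by apply: he'; rewrite s2.
have := convex_set_seg cZ Zd Zd' (_ : 0 <= 1 / 2 <= 1).
move=> /(_ ltac:(lra)); congr Z; apply/rowP => i; by rewrite !mxE; field.
Qed.

Lemma bidirZ Z w d a : bidir Z w d -> bidir Z w (a *: d).
Proof.
move=> [e e0 he]; exists (e / (`|a| + 1)).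
  by rewrite divr_gt0// ltr_wpDl.
move=> s; rewrite ler_pdivlMr ?ltr_wpDl// => h.
rewrite scalerA; apply: he; rewrite normrM; apply: le_trans h.
by rewrite ler_wpM2l// lerDl.
Qed.

Lemma bidir_sum Z w (q : nat) (F : 'I_q -> 'rV[R]_n) : convex_set Z -> Z w ->
  (forall i, bidir Z w (F i)) -> bidir Z w (\sum_i F i).
Proof.
move=> cZ Zw hF; apply: (big_ind (bidir Z w)) => //; first exact: bidir0.
by move=> *; exact: bidirD.
Qed.

(** A point whose space of two-sided directions has maximal dimension is in the
    core: moving halfway to [z] keeps these directions and adds [z - w], which
    therefore was among them already. *)
Lemma core_exists Z z0 : convex_set Z -> Z z0 -> exists w, core Z w.
Proof.
move=> cZ Zz0.
pose P r := `[< exists q (M : 'M[R]_(q, n)) w,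
  [/\ Z w, forall i, bidir Z w (row i M) & \rank M = r] >].
have exP : exists r, P r.
  exists 0%N; apply/asboolP; exists 0%N, 0, z0.
  by split=> //; [case | rewrite mxrank0].
have ubP r : P r -> (r <= n)%N.
  by move/asboolP => [q [M [w [_ _ <-]]]]; exact: rank_leq_col.
case: (ex_maxnP exP ubP) => r /asboolP[q [M [w [Zw hM rM]]]] rmax.
exists w; split => // z Zz.
have midE s d : w + (1 / 2) *: (z - w) + s *: d =
    (w + (2 * s) *: d) + (1 / 2) *: (z - (w + (2 * s) *: d)).
  by apply/rowP => i; rewrite !mxE; field.
pose w' := w + (1 / 2) *: (z - w).
have Zw' : Z w' by apply: convex_set_seg => //; lra.
have sub d : bidir Z w d -> bidir Z w' d.
  move=> [e e0 he]; exists (e / 2); first by rewrite divr_gt0.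
  move=> s hs; rewrite /w' midE; apply: convex_set_seg => //; last by lra.
  by apply: he; rewrite normrM ger0_norm//; lra.
have dz : bidir Z w' (z - w).
  exists (1 / 2); first by lra.
  move=> s; rewrite ler_norml => hs.
  rewrite /w' -addrA -scalerDl; apply: convex_set_seg => //; lra.
have /rmax : P (\rank (col_mx M (z - w))).
  apply/asboolP; exists (q + 1)%N, (col_mx M (z - w)), w'; split => // i.
  case: (split_ordP i) => j ->; first by rewrite rowKu; exact: sub.
  by rewrite rowKd (_ : row j _ = z - w)//; apply/rowP=> k; rewrite mxE ord1.
rewrite -rM => rle.
have Msub : (M <= col_mx M (z - w))%MS.
  by rewrite -addsmxE addsmxSl.
have := mxrank_leqif_sup Msub; move/geq_leqif; rewrite rle.
rewrite col_mx_sub submx_refl/= => /esym/submxP[D ->].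
rewrite mulmx_sum_row; apply: bidir_sum => // i.
exact: bidirZ.
Qed.

Lemma core_seg Z w p s : convex_set Z -> core Z w -> Z p -> 0 < s <= 1 ->
  core Z (p + s *: (w - p)).
Proof.
move=> cZ [Zw hw] Zp /andP[s0 s1].
have Zy : Z (p + s *: (w - p)) by apply: convex_set_seg => //; rewrite ltW.
have sub d : bidir Z w d -> bidir Z (p + s *: (w - p)) d.
  move=> [e e0 he]; exists (s * e); first by rewrite mulr_gt0.
  move=> t ht; rewrite (_ : _ + _ = p + s *: ((w + (t / s) *: d) - p)).
    apply: convex_set_seg => //; last by rewrite ltW.
    by apply: he; rewrite normrM normfV (gtr0_norm s0) ler_pdivrMr// mulrC.
  by apply/rowP => i; rewrite !mxE; field; rewrite gt_eqF.
split => // z Zz; apply: sub.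
rewrite (_ : z - _ = (z - w) + (s - 1) *: (p - w)); last first.
  by apply/rowP => i; rewrite !mxE; ring.
by apply: bidirD => //; [exact: hw | apply/bidirZ/hw].
Qed.

(** The Hahn-Banach argument, one coordinate at a time: a functional that
    supports [h] on the points of [Z] that differ from [w] only in the first [j]
    coordinates extends to coordinate [j].  The new coefficient must separate
    the slopes of [h] on both sides; these slopes are comparable by convexity,
    and as [w] is in the core either both sides contain points or none does. *)
Lemma core_subgradient Z h w : convex_set Z -> convex_function Z h ->
  core Z w -> exists g, is_subgradient Z h w g.
Proof.
move=> cZ ch [Zw hw].
pose supported j z := forall i : 'I_n, (j <= i)%N -> (z - w) 0 i = 0.
suff /(_ n (leqnn n)) [g hg] : forall j, (j <= n)%N -> exists g, forall z,
    Z z -> supported j z -> h w + dotp g (z - w) <= h z.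
  by exists g => z Zz; apply: hg => // i; rewrite leqNgt ltn_ord.
elim => [_|j IH jn].
  exists 0 => z _ sz; rewrite dotp0l addr0 (_ : z = w)//.
  by apply/rowP => i; have /eqP := sz i isT; rewrite !mxE subr_eq0 => /eqP.
have [g hg] := IH (ltnW jn).
pose o := Ordinal jn.
pose t z := (z - w) 0 o.
pose slope z := (h z - h w - dotp g (z - w)) / t z.
have slope_le z z' : Z z -> Z z' -> supported j.+1 z -> supported j.+1 z' ->
    t z < 0 -> 0 < t z' -> slope z <= slope z'.
  move=> Zz Zz' sz sz' tz tz'.
  have d0 : 0 < t z' - t z by lra.
(* The point of the segment from [z] to [z'] whose coordinate [j] is that of
   [w], where the induction hypothesis applies. *)
  pose s := - t z / (t z' - t z).
  have s0 : 0 < s by rewrite divr_gt0//; lra.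
  have s1 : s < 1 by rewrite ltr_pdivrMr//; lra.
  have s01 : 0 <= s <= 1 by rewrite !ltW.
  have sE : (1 - s) * t z + s * t z' = 0.
    by rewrite /s; field; rewrite gt_eqF.
  pose y := z + s *: (z' - z).
  have ywE : y - w = (1 - s) *: (z - w) + s *: (z' - w).
    by apply/rowP => i; rewrite !mxE; ring.
  have Zy : Z y by exact: convex_set_seg.
  have sy : supported j y.
    move=> i; rewrite leq_eqVlt => /orP[/eqP ji|ji].
      have -> : i = o by exact/val_inj.
      by rewrite ywE mxE [X in X + _]mxE [X in _ + X]mxE.
    by rewrite ywE mxE [X in X + _]mxE [X in _ + X]mxE sz// sz'// !mulr0 addr0.
  have := hg y Zy sy; have := convex_function_seg ch Zz Zz' s01.
  rewrite -/y ywE !dotp_lin.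
  pose A := h z - h w - (dotp g z - dotp g w).
  pose B := h z' - h w - (dotp g z' - dotp g w).
  move=> h1 h2; have h3 : 0 <= (1 - s) * A + s * B by rewrite /A /B; lra.
  rewrite /slope !dotp_lin -/A -/B ler_ndivrMr// mulrAC ler_pdivrMr//.
  have : 0 <= ((1 - s) * A + s * B) * (t z' - t z).
    by rewrite mulr_ge0// ltW.
  rewrite (_ : _ * (t z' - t z) = A * t z' - B * t z).
    lra.
  by rewrite /s; field; rewrite gt_eqF.
have opp z : Z z -> supported j.+1 z -> exists z', [/\ Z z', supported j.+1 z' &
    exists2 e, 0 < e & t z' = - e * t z].
  move=> Zz sz; have [e e0 he] := hw z Zz.
  have tE i : (w + - e *: (z - w) - w) 0 i = - e * (z - w) 0 i.
    by rewrite !mxE; ring.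
  exists (w + - e *: (z - w)); split; last by exists e => //; rewrite /t tE.
    by apply: he; rewrite normrN gtr0_norm.
  by move=> i ji; rewrite tE sz// mulr0.
(* If [A] is empty then so is the side [0 < t], and any coefficient will do. *)
pose A := [set slope z | z in [set z | [/\ Z z, supported j.+1 z & t z < 0]]].
pose a := sup A.
have A_ub z : Z z -> supported j.+1 z -> 0 < t z -> ubound A (slope z).
  by move=> Zz sz tz _ [y [Zy sy ty] <-]; exact: slope_le.
exists (g + a *: delta_mx 0 o) => z Zz sz.
have -> : dotp (g + a *: delta_mx 0 o) (z - w) = dotp g (z - w) + a * t z.
  rewrite dotpDl dotpZl; congr (_ + _ * _).
  rewrite dotpE (bigD1 o)//= mxE !eqxx mul1r big1 ?addr0// => i io.
  by rewrite mxE (negbTE io) mul0r.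
have [tz|tz|tz] := ltgtP (t z) 0.
- have [z' [Zz' sz' [e e0 tz'E]]] := opp z Zz sz.
  have tz' : 0 < t z' by rewrite tz'E; nra.
  have : slope z <= a.
    by apply: ub_le_sup; [exists (slope z'); exact: A_ub | exists z].
  rewrite ler_ndivrMr//; lra.
- have [z' [Zz' sz' [e e0 tz'E]]] := opp z Zz sz.
  have tz' : t z' < 0 by rewrite tz'E; nra.
  have : a <= slope z by apply: ge_sup; [exists (slope z'), z' | exact: A_ub].
  rewrite ler_pdivlMr//; lra.
- rewrite tz mulr0 addr0; apply: hg => // i.
  rewrite leq_eqVlt => /orP[/eqP ji|]; last exact: sz.
  by have -> : i = o by exact/val_inj.
Qed.

End Convexity.

(** * Optimality and strong convexity in a proximal setup *)
Section Norm.
Context {R : realType} {n : nat} (N : 'rV[R]_n -> R) (hN : is_norm N).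

Lemma is_norm0 : N 0 = 0.
Proof. by rewrite -(scale0r 0) (is_norm_scale hN) normr0 mul0r. Qed.

Lemma is_normN u : N (- u) = N u.
Proof. by rewrite -scaleN1r (is_norm_scale hN) normrN1 mul1r. Qed.

Lemma is_norm_ge0 u : 0 <= N u.
Proof.
have := is_norm_triangle hN u (- u); rewrite subrr is_norm0 is_normN; lra.
Qed.

Lemma is_norm_distC u v : N (u - v) = N (v - u).
Proof. by rewrite -is_normN opprB. Qed.

End Norm.

Lemma le0_of_natdiv (R : realType) (a b : R) : 0 <= b ->
  (forall K : nat, (0 < K)%N -> a <= b / K%:R) -> a <= 0.
Proof.
move=> b0 h; rewrite leNgt; apply/negP => a0.
have ba : 0 <= b / a by rewrite divr_ge0// ltW.
have hK := archi_boundP ba.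
have := h (Num.bound (b / a)); rewrite -(ltr_nat R) (le_lt_trans ba hK).
move=> /(_ isT); rewrite ler_pdivlMr ?(le_lt_trans ba hK)//.
by rewrite leNgt mulrC -ltr_pdivrMr// hK.
Qed.

(** Strong monotonicity of the gradient along a segment is integrated by
    cutting the segment into [K] equal pieces: the subgradient inequalities at
    the left ends add up to [N d ^+ 2 / 2 * (1 - 1 / K)].  Only
    left ends occur, so [z + d] may be a boundary point without subgradient, as
    on the simplex. *)
Lemma bregman_ge_half_sq_seg (R : realType) (n : nat) (P : prox_data R n)
    (z d : 'rV[R]_n) :
    is_norm (pnorm P) ->
    (forall s : R, 0 <= s < 1 -> [/\ pdom P (z + s *: d),
      is_subgradient (pdom P) (dgf P) (z + s *: d) (dgf_grad P (z + s *: d)) &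
      pnorm P (s *: d) ^+ 2 <=
        dotp (dgf_grad P (z + s *: d) - dgf_grad P z) (s *: d)]) ->
    pdom P (z + d) ->
  pnorm P d ^+ 2 / 2 <= bregman P z (z + d).
Proof.
move=> hN hseg Zd.
set nd := pnorm P d ^+ 2.
rewrite -subr_le0; apply: (@le0_of_natdiv _ _ (nd / 2)).
  by rewrite divr_ge0 ?sqr_ge0.
move=> K K0; have K0' : 0 < K%:R :> R by rewrite ltr0n.
have Kn0 : K%:R != 0 :> R by rewrite gt_eqF.
pose y (j : nat) := z + (j%:R / K%:R : R) *: d.
have Zy j : (j <= K)%N -> pdom P (y j).
  rewrite leq_eqVlt => /orP[/eqP -> | jK].
    by rewrite /y divff// scale1r.
  by have [] := hseg (j%:R / K%:R); rewrite ?divr_ge0// ltr_pdivrMr// mul1r ltr_nat.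
have step j : (j < K)%N -> dotp (dgf_grad P z) d + nd * (j%:R / K%:R) <=
    K%:R * (dgf P (y j.+1) - dgf P (y j)).
  move=> jK; set s : R := j%:R / K%:R.
  have s0 : 0 <= s by rewrite divr_ge0.
  have s1 : s < 1 by rewrite ltr_pdivrMr// mul1r ltr_nat.
  have [_ hsub hmon] := hseg s ltac:(by rewrite s0).
  have := hsub _ (Zy _ jK).
  rewrite (_ : y j.+1 - (z + s *: d) = K%:R^-1 *: d); last first.
    apply/rowP => i; rewrite !mxE /s -natr1.
    by field.
  rewrite -[z + s *: d]/(y j) dotpZr addrC -lerBrDr mulrC ler_pdivrMr// mulrC.
  apply: le_trans; rewrite -[y j]/(z + s *: d).
  move: hmon; rewrite (is_norm_scale hN) exprMn real_normK ?num_real//.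
  rewrite -/nd dotpZr dotpBl expr2 -mulrA.
  have [->|sn0] := eqVneq s 0.
    by rewrite scale0r addr0 mulr0 addr0.
  have sp : 0 < s by rewrite lt_neqAle eq_sym sn0.
  rewrite ler_pM2l//; lra.
have sum j : (j <= K)%N -> j%:R * dotp (dgf_grad P z) d
    + nd * (j%:R * (j%:R - 1) / (2 * K%:R)) <= K%:R * (dgf P (y j) - dgf P z).
  elim: j => [_|j IH jK].
    have -> : y 0%N = z by rewrite /y mul0r scale0r addr0.
    by rewrite subrr !mul0r !mulr0 addr0.
  have := IH (ltnW jK); have := step _ jK.
  have -> : j.+1%:R = j%:R + 1 :> R by rewrite -natr1.
  rewrite (_ : (j%:R + 1) * (j%:R + 1 - 1) / (2 * K%:R) =
    j%:R * (j%:R - 1) / (2 * K%:R) + j%:R / K%:R :> R); last by field.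
  rewrite (mulrDr nd); lra.
have := sum K (leqnn K).
have -> : y K = z + d by rewrite /y divff// scale1r.
have -> : bregman P z (z + d) =
    dgf P (z + d) - dgf P z - dotp (dgf_grad P z) d.
  by rewrite /bregman (addrC z) addrK.
rewrite (_ : K%:R * (K%:R - 1) / (2 * K%:R) = (K%:R - 1) / 2 :> R); last first.
  by field.
rewrite (_ : nd * ((K%:R - 1) / 2) = K%:R * (nd / 2 - nd / 2 / K%:R)); last first.
  by field.
rewrite -mulrDr ler_pM2l//; lra.
Qed.

Section Prox.
Context {R : realType} {n : nat} (P : prox_data R n) (hP : proximal_setup P).
Local Notation Z := (pdom P).
Local Notation Zo := (pdomo P).
Local Notation omega := (dgf P).
Local Notation grad := (dgf_grad P).
Local Notation N := (pnorm P).
Let cZ := setup_convex hP.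
Let cw := setup_dgf_convex hP.
Let hN := setup_norm hP.

Lemma core_pdomo w : core Z w -> Zo w.
Proof. by move=> cow; split; [case: cow | exact: core_subgradient]. Qed.

(** The gradient is continuous only relative to the set of points with a
    subgradient, so the segment has to lie in that set. *)
Lemma grad_right_cont (p d : 'rV[R]_n) (e : R) : Zo p -> 0 < e ->
    (forall s : R, 0 < s <= 1 -> Zo (p + s *: d)) ->
  exists2 s0 : R, 0 < s0 & forall s : R, 0 < s < s0 -> s <= 1 ->
    dotp (grad (p + s *: d)) d <= dotp (grad p) d + e.
Proof.
move=> Zp e0 hd.
have /subspace_continuousP/(_ p Zp) := setup_grad_continuous hP.
pose K := \sum_i `|d 0 i| + 1.
have K0 : 0 < K by rewrite ltr_wpDl// sumr_ge0.
move/cvgr_distC_le => /(_ (e / K)); rewrite divr_gt0// => /(_ isT).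
rewrite /within/= => /nbhs_ballP[r /= r0 hr].
have D0 : 0 < `|d| + 1 by rewrite ltr_wpDl.
exists (r / (`|d| + 1)); first by rewrite divr_gt0.
move=> s /andP[s0 sr] s1.
have := hr (p + s *: d); rewrite -ball_normE/= opprD addrA subrr sub0r normrN.
rewrite normrZ gtr0_norm//.
have sd : s * `|d| < r.
  move: sr; rewrite ltr_pdivlMr//; apply: le_lt_trans.
  by rewrite ler_pM2l// lerDl.
move=> /(_ sd (hd s ltac:(by rewrite s0 s1))) hG.
rewrite -lerBlDl -dotpBl; apply: le_trans (dotp_le_supnorm _ _) _.
apply: le_trans (ler_wpM2r _ hG) _; first by rewrite sumr_ge0.
by rewrite mulrAC ler_pdivrMr// ler_pM2l// /K lerDl.
Qed.

(** The sum rule for subdifferentials, with the chosen gradient of [omega].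
    Towards a core point [w] the whole segment consists of points with a
    subgradient, so [omega (p + s d) - omega p <= s <grad (p + s d), d>]; since
    the gradient is continuous, the directional derivative of [omega] is at
    most [<grad p, d>], and the convex [h] must make up for the rest of [a].
    A general [w] is the limit of points of a segment ending in the core, on
    which the claim is preserved because [h] is convex. *)
Lemma subgradient_sum_rule (h : 'rV[R]_n -> R) c p a : 0 <= c ->
  convex_function Z h -> Zo p ->
  is_subgradient Z (fun z => h z + c * omega z) p a ->
  is_subgradient Z h p (a - c *: grad p).
Proof.
move=> c0 ch Zp ha.
have Zp' : Z p by case: Zp.
have oncore w : core Z w -> h p + dotp (a - c *: grad p) (w - p) <= h w.
  move=> cow; pose d := w - p.
  have Zw : Z w by case: cow.
  have hd s : 0 < s <= 1 -> Zo (p + s *: d).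
    by move=> s01; exact/core_pdomo/core_seg.
  apply/ler_addgt0Pr => e e0.
  have e'0 : 0 < e / (c + 1) by rewrite divr_gt0// ltr_wpDl.
  have [s0 s00 hs0] := grad_right_cont Zp e'0 hd.
(* Small enough for the gradient to have varied by at most [e / (c + 1)],
   which contributes at most [e] after multiplication by [c]. *)
  pose s := Num.min 1 (s0 / 2).
  have s_gt0 : 0 < s by rewrite lt_min ltr01 divr_gt0.
  have s1 : s <= 1 by rewrite ge_min lexx.
  have ss0 : s < s0 by rewrite gt_min; apply/orP; right; lra.
  have Zy : Zo (p + s *: d) by apply: hd; rewrite s_gt0.
  have Zy' : Z (p + s *: d) by case: Zy.
  have := hs0 s; rewrite s_gt0 ss0 => /(_ isT s1) hg.
  have := ha _ Zy'; have := setup_grad hP Zy Zp'.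
  rewrite (_ : p - (p + s *: d) = - s *: d); last first.
    by apply/rowP => i; rewrite !mxE; ring.
  rewrite (_ : p + s *: d - p = s *: d); last first.
    by apply/rowP => i; rewrite !mxE; ring.
  have s01 : 0 <= s <= 1 by rewrite (ltW s_gt0).
  have := convex_function_seg ch Zp' Zw s01; rewrite -/d.
  have ce : c * (e / (c + 1)) <= e.
    by rewrite mulrA ler_pdivrMr ?ltr_wpDl//; nra.
  rewrite (dotpBl a) dotpZl !dotpZr.
  set D := dotp (grad (p + s *: d)) d in hg *.
  set D0 := dotp (grad p) d in hg *.
  set W := omega (p + s *: d).
  move=> h1 h2 h3.
  have h4 : c * (W - omega p) <= c * (s * D) by apply: ler_wpM2l => //; lra.
  have h5 : c * D <= c * D0 + e.
    by apply: (le_trans (ler_wpM2l c0 hg)); rewrite mulrDr lerD2l.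
  have h6 : s * (dotp a d - c * D) <= s * (h w - h p) by lra.
  have h7 : dotp a d - c * D <= h w - h p by rewrite -(ler_pM2l s_gt0).
  lra.
move=> z Zz; have [w cow] := core_exists cZ Zp'.
have Zw : Z w by case: cow.
rewrite -subr_le0.
apply: (@le0_of_small _ _ ((h w - h p - dotp (a - c *: grad p) (w - p))
  - (h z - h p - dotp (a - c *: grad p) (z - p)))) => s /andP[s0 s1].
have s01 : 0 < s <= 1 by rewrite s0 ltW.
have := oncore _ (core_seg cZ cow Zz s01).
have s02 : 0 <= s <= 1 by rewrite !ltW.
have := convex_function_seg ch Zz Zw s02.
rewrite (_ : _ - p = (z - p) + s *: ((w - p) - (z - p))); last first.
  by apply/rowP => i; rewrite !mxE; ring.
rewrite (dotpDr _ (z - p)) dotpZr (dotpBr _ (w - p)).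
lra.
Qed.

Lemma is_prox_pdomo z xi p : is_prox P z xi p -> Zo p.
Proof.
move=> [Zp hp]; split => //; exists (grad z - xi) => w Zw.
have := hp w Zw; rewrite /bregman !dotp_lin; lra.
Qed.

Lemma is_center_pdomo p : is_center P p -> Zo p.
Proof.
move=> [Zp hp]; split => //; exists 0 => w Zw.
by rewrite dotp0l addr0; exact: hp.
Qed.

Lemma affine_convex g c : convex_function Z (fun z => dotp g z + c).
Proof.
move=> t x y _ _; rewrite /conv/= /unstable.onem/= dotpDr !dotpZr.
set s := t%:num.
suff <- : s * (dotp g x + c) + (1 - s) * (dotp g y + c) =
  s * dotp g x + (1 - s) * dotp g y + c by [].
ring.
Qed.

(** The optimality condition of the prox-mapping is the sum rule for a linear
    [h]; the rest is the three-point identity of Bregman distances. *)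
Lemma prox_three_point z xi p w : is_prox P z xi p -> Z w ->
  dotp xi (p - w) <= bregman P z w - bregman P p w - bregman P z p.
Proof.
move=> hp Zw; have Zp := is_prox_pdomo hp; case: (hp) => _ hmin.
have sub : is_subgradient Z
    (fun y => (dotp (xi - grad z) y + 0) + 1 * omega y) p 0.
  move=> y Zy; have := hmin y Zy.
  rewrite /bregman !dotp_lin; lra.
have := subgradient_sum_rule ler01 (@affine_convex _ _) Zp sub Zw.
rewrite /bregman scale1r !dotp_lin; lra.
Qed.

Lemma center_grad_ge0 p w : is_center P p -> Z w -> 0 <= dotp (grad p) (w - p).
Proof.
move=> hp Zw; have Zp := is_center_pdomo hp; case: (hp) => _ hmin.
have sub : is_subgradient Z (fun y => (dotp 0 y + 0) + 1 * omega y) p 0.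
  move=> y Zy; have := hmin y Zy.
  rewrite !dotp_lin; lra.
have := subgradient_sum_rule ler01 (@affine_convex _ _) Zp sub Zw.
rewrite scale1r !dotp_lin; lra.
Qed.

(** A setup fixes its width through some center, which has to be identified
    with the starting point of the iterations. *)
Lemma center_unique p q : is_center P p -> is_center P q -> p = q.
Proof.
move=> hp hq; have [Zp _] := hp; have [Zq _] := hq.
have := center_grad_ge0 hp Zq; have := center_grad_ge0 hq Zp.
have := setup_strong hP (is_center_pdomo hp) (is_center_pdomo hq).
rewrite !dotp_lin => h1 h2 h3.
apply/eqP; rewrite -subr_eq0; apply/eqP/(is_norm_eq0 hN)/eqP.
by rewrite -sqrf_eq0 eq_le sqr_ge0 andbT; lra.
Qed.

(** On a segment from [z] to a core point, [bregman_ge_half_sq_seg] applies.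
    Any other point is the limit of a segment ending in the core, along which
    convexity bounds the Bregman distance from above. *)
Lemma bregman_ge_half_sq z w : Zo z -> Z w ->
  N (w - z) ^+ 2 / 2 <= bregman P z w.
Proof.
move=> Zz Zw; have Zz' : Z z by case: Zz.
have oncore u : core Z u -> N (u - z) ^+ 2 / 2 <= bregman P z u.
  move=> cou; have Zu : Z u by case: cou.
  have uE : u = z + (u - z) by rewrite addrC subrK.
  rewrite {2}uE; apply: bregman_ge_half_sq_seg => //; last by rewrite -uE.
  move=> s /andP[s0 s1].
  have Zy : Zo (z + s *: (u - z)).
    have [->|sn0] := eqVneq s 0; first by rewrite scale0r addr0.
    by apply/core_pdomo/core_seg => //; rewrite lt_neqAle eq_sym sn0 s0 ltW.
  split; [by case: Zy | exact: setup_grad |].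
  by have := setup_strong hP Zy Zz; rewrite (addrC z) addrK.
have [u cou] := core_exists cZ Zz'; have Zu : Z u by case: cou.
rewrite -subr_le0.
apply: (@le0_of_small _ _ (bregman P z u - bregman P z w
  + N (w - z) * N (u - w))) => s /andP[s0 s1].
have s01 : 0 < s <= 1 by rewrite s0 ltW.
have s02 : 0 <= s <= 1 by rewrite !ltW.
have := oncore _ (core_seg cZ cou Zw s01).
have := convex_function_seg cw Zw Zu s02.
set y := w + s *: (u - w) => h1 h2.
have h3 : bregman P z y <= bregman P z w + s * (bregman P z u - bregman P z w).
  rewrite /bregman /y !dotp_lin in h1 *; lra.
have h4 : N (w - z) <= N (y - z) + s * N (u - w).
  rewrite (_ : w - z = (y - z) + - s *: (u - w)); last first.
    by apply/rowP => i; rewrite !mxE; ring.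
  apply: le_trans (is_norm_triangle hN _ _) _.
  by rewrite (is_norm_scale hN) normrN gtr0_norm.
have := is_norm_ge0 hN (w - z); have := is_norm_ge0 hN (y - z).
have := is_norm_ge0 hN (u - w).
move: (N (w - z)) (N (y - z)) (N (u - w)) h2 h4 => A B C h2 h4 C0 B0 A0.
have h5 : A ^+ 2 <= B ^+ 2 + 2 * s * (A * C).
  have [AB|BA] := leP A B.
    have : 0 <= s * (A * C) by rewrite !mulr_ge0// ltW.
    have : A ^+ 2 <= B ^+ 2 by rewrite !expr2 ler_pM.
    lra.
  have : (A - B) * (A + B) <= s * C * (A + B) by apply: ler_wpM2r; lra.
  have : s * C * (A + B) <= s * C * (2 * A).
    by apply: ler_wpM2l; [rewrite mulr_ge0// ltW | lra].
  rewrite (_ : (A - B) * (A + B) = A ^+ 2 - B ^+ 2); last by ring.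
  lra.
lra.
Qed.

End Prox.

(** * The negative entropy on the simplex *)
Section LogInequalities.
Context {R : realType}.
Implicit Types a b c x : R.

Lemma ln_le_subr1 x : 0 < x -> ln x <= x - 1.
Proof.
move=> x0; have -> : ln x = ln (1 + (x - 1)) by rewrite addrC subrK.
by apply: le_ln1Dx; lra.
Qed.

(** The tangent inequality of [a * ln a] at [c]; it includes [a = 0] because
    [ln 0 = 0]. *)
Lemma mul_ln_tangent a c : 0 <= a -> 0 < c -> a * ln c - a * ln a <= c - a.
Proof.
rewrite le_eqVlt => /orP[/eqP<- c0|a0 c0]; first by rewrite !mul0r !subr0 ltW.
rewrite -mulrBr -ln_div ?posrE//.
apply: (le_trans (ler_wpM2l (ltW a0) (ln_le_subr1 (divr_gt0 c0 a0)))).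
by rewrite mulrBr mulr1 mulrC divfK// gt_eqF.
Qed.

Lemma mul_ln_chi2 a c : 0 <= a -> 0 < c -> a * ln a - a * ln c <= a * (a / c - 1).
Proof.
rewrite le_eqVlt => /orP[/eqP<- c0|a0 c0]; first by rewrite !mul0r subr0.
rewrite -mulrBr -ln_div ?posrE//.
apply: ler_wpM2l; first exact: ltW.
by apply: ln_le_subr1; rewrite divr_gt0.
Qed.

Lemma ln_ge_subVr1 x : 0 < x -> 1 - x^-1 <= ln x.
Proof.
move=> x0; have := @ln_le_subr1 x^-1; rewrite invr_gt0 lnV ?posrE// => /(_ x0).
lra.
Qed.

(** Both sides agree at 1 and the derivative of their difference is
    [ln x - (1 - 1 / x)]. *)
Lemma ln_ge_pade x : 1 <= x -> 2 * (x - 1) <= (x + 1) * ln x.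
Proof.
move=> x1.
pose g (y : R) := (y + 1) * ln y - 2 * y.
have dg (y : R) : 0 < y -> is_derive y 1 g (ln y + y^-1 - 1).
  move=> y0; have dln := is_derive1_ln y0.
  have dN : is_derive y 1 (fun y : R => y + 1) 1.
    by apply: is_derive_eq; rewrite addr0.
  have dM := is_deriveM dN dln.
  have d2 : is_derive y 1 (2 \*: (id : R -> R)) (2 *: 1).
    exact: is_deriveZ.
  have := is_deriveB dM d2.
  rewrite (_ : _ - _ = g) //; move=> dd; apply: is_derive_eq dd _.
  rewrite /GRing.scale/=; field; lra.
suff : g 1 <= g x by rewrite /g ln1; lra.
apply: (@ger0_derive1_ndecry R g 1) => //.
- move=> y; rewrite in_itv/= andbT => y1.
  by apply: ex_derive; apply: dg; lra.
- move=> y; rewrite in_itv/= andbT => y1; have y0 : 0 < y by lra.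
  have := dg y y0 => dgy; rewrite derive1E derive_val.
  have := ln_ge_subVr1 y0; lra.
- apply: derivable_within_continuous => y; rewrite in_itv/= andbT => y1.
  by apply: ex_derive; apply: dg; lra.
Qed.

(** The logarithmic mean is at most the arithmetic mean. *)
Lemma ln_sub_mono a b : 0 < a -> 0 < b ->
  2 * (a - b) ^+ 2 <= (a + b) * ((ln a - ln b) * (a - b)).
Proof.
wlog ba : a b / b <= a => [hw a0 b0|a0 b0].
  have [|/ltW] := leP b a; first by move=> ba; exact: hw.
  move=> ab; have := hw b a ab b0 a0.
  rewrite (_ : (b - a) ^+ 2 = (a - b) ^+ 2); last by ring.
  lra.
have x1 : 1 <= a / b by rewrite ler_pdivlMr// mul1r.
have := ln_ge_pade x1; rewrite ln_div ?posrE// => h.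
have bab : 0 <= b * (a - b) by rewrite mulr_ge0 ?subr_ge0// ltW.
have := ler_wpM2r bab h.
rewrite (_ : 2 * (a / b - 1) * (b * (a - b)) = 2 * (a - b) ^+ 2); last first.
  by field; rewrite gt_eqF.
move/le_trans; apply; rewrite le_eqVlt; apply/orP; left; apply/eqP.
by field; rewrite gt_eqF.
Qed.

(** The term-by-term form of the Cauchy-Schwarz inequality behind Pinsker's
    inequality: summed over a pair of probability vectors with [l] their l1
    distance, the left-hand side becomes [l ^+ 2]. *)
Lemma ln_sub_mono_weighted a b l : 0 < a -> 0 < b ->
  2 * l * `|a - b| - l ^+ 2 * ((a + b) / 2) <= (ln a - ln b) * (a - b).
Proof.
move=> a0 b0; have ab0 : 0 < a + b by lra.
rewrite -(ler_pM2l ab0); apply: le_trans (ln_sub_mono a0 b0).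
rewrite -[(a - b) ^+ 2]real_normK ?num_real//.
have := sqr_ge0 (2 * `|a - b| - l * (a + b)).
set A := `|_|; set s := a + b.
rewrite (_ : (2 * A - l * s) ^+ 2 =
  2 * (2 * A ^+ 2 - s * (2 * l * A - l ^+ 2 * (s / 2)))); last by field.
lra.
Qed.

End LogInequalities.

Section Simplex.
Context {R : realType} {m : nat}.
Local Notation S := (simplex_data R m).
Local Notation H := (dgf S).
Local Notation dH := (dgf_grad S).
Implicit Types c p q w y z g a xi : 'rV[R]_m.

Definition positive y := forall i, 0 < y 0 i.

Lemma is_norm_l1 : is_norm (pnorm S).
Proof.
split=> [u v|a u|u] /=.
- rewrite -big_split/=; apply: ler_sum => i _; rewrite mxE; exact: ler_normD.
- by rewrite mulr_sumr; apply: eq_bigr => i _; rewrite mxE normrM.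
- move/eqP; rewrite psumr_eq0// => /allP h; apply/rowP => i.
  by have /h := mem_index_enum i; rewrite normr_eq0 => /eqP ->; rewrite mxE.
Qed.

Lemma simplex_le1 y i : pdom S y -> y 0 i <= 1.
Proof.
by move=> [y0 <-]; rewrite (bigD1 i)//= lerDl sumr_ge0.
Qed.

Lemma simplex_convex : convex_set (pdom S).
Proof.
move=> x y t /set_mem [x0 x1] /set_mem [y0 y1]; apply/mem_set.
rewrite /conv/= /unstable.onem/=.
have t0 : 0 <= t%:num by [].
have t1 : t%:num <= 1 by [].
split=> [i|]; first by rewrite !mxE addr_ge0// mulr_ge0// subr_ge0.
under eq_bigr => i _ do rewrite !mxE.
by rewrite big_split/= -!mulr_sumr x1 y1 !mulr1 addrC subrK.
Qed.

(** Hence adding a constant to all coordinates of a gradient changes no inner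
    product with a direction of the simplex. *)
Lemma simplex_dir_sum0 y w : pdom S y -> pdom S w -> \sum_i (w 0 i - y 0 i) = 0.
Proof. by move=> [_ y1] [_ w1]; rewrite sumrB y1 w1 subrr. Qed.

Lemma dotp_dH c y w : pdom S y -> pdom S w ->
  dotp (dH c) (w - y) = \sum_i ln (c 0 i) * (w 0 i - y 0 i).
Proof.
move=> Sy Sw; rewrite dotpE.
transitivity (\sum_i ln (c 0 i) * (w 0 i - y 0 i) + \sum_i (w 0 i - y 0 i));
  last by rewrite (simplex_dir_sum0 Sy Sw) addr0.
rewrite -big_split/=.
by apply: eq_bigr => i _; rewrite !mxE; ring.
Qed.

Lemma entropy_subgradient c : pdom S c -> positive c ->
  is_subgradient (pdom S) H c (dH c).
Proof.
move=> Sc c0 y Sy; rewrite dotp_dH// -big_split/=.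
rewrite -[leRHS]addr0 -[X in _ <= _ + X](simplex_dir_sum0 Sy Sc).
rewrite -big_split/=; apply: ler_sum => i _; case: Sy => y0 _.
have := mul_ln_tangent (y0 i) (c0 i); lra.
Qed.

(** Relative entropy is at most the chi-square divergence, so that on a
    segment from [p] it is of second order. *)
Lemma kl_le_chi2 p q : pdom S p -> positive p -> pdom S q ->
  bregman S p q <= \sum_i (q 0 i - p 0 i) ^+ 2 / p 0 i.
Proof.
move=> Sp p0 Sq; rewrite /bregman dotp_dH//=.
rewrite -[leLHS]addr0 -[X in _ + X <= _](simplex_dir_sum0 Sq Sp) -!sumrB -big_split/=.
apply: ler_sum => i _; case: Sq => q0 _.
have := mul_ln_chi2 (q0 i) (p0 i).
rewrite (_ : (q 0 i - p 0 i) ^+ 2 / p 0 i =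
  q 0 i * (q 0 i / p 0 i - 1) - q 0 i + p 0 i).
  lra.
by field; rewrite gt_eqF.
Qed.

Lemma uniform_simplex : (0 < m)%N -> pdom S (const_mx (m%:R^-1)).
Proof.
move=> m0; split=> [i|]; first by rewrite mxE invr_ge0.
under eq_bigr => i _ do rewrite mxE.
rewrite sumr_const card_ord -[_ *+ _]mulr_natr mulVf// pnatr_eq0 -lt0n//.
Qed.

Lemma simplex_pos_dim y : pdom S y -> (0 < m)%N.
Proof.
case: (posnP m) => // m0 [_]; rewrite big1 => [/eqP|i _].
  by rewrite eq_sym oner_eq0.
by suff : (i < 0)%N by []; rewrite -[X in (_ < X)%N]m0.
Qed.

Lemma positive_seg z w (s : R) : pdom S w -> positive z -> 0 <= s < 1 ->
  positive (z + s *: (w - z)).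
Proof.
move=> [w0 _] z0 /andP[s0 s1] i; rewrite !mxE.
have := z0 i; have := w0 i => wi zi.
have : 0 < (1 - s) * z 0 i by rewrite mulr_gt0// subr_gt0.
have : 0 <= s * w 0 i by rewrite mulr_ge0.
lra.
Qed.

(** At a zero coordinate the entropy has slope minus infinity: moving towards
    the uniform distribution by [s] bounds any subgradient in that direction by
    [K + u * ln s], which tends to minus infinity with [s]. *)
Lemma pdomo_positive y : pdomo S y -> positive y.
Proof.
move=> [Sy [g hg]] i; have [y0 _] := Sy; rewrite lt_neqAle y0 andbT.
apply/eqP => /esym yi.
have m0 := simplex_pos_dim Sy.
pose u : R := m%:R^-1; pose w : 'rV[R]_m := const_mx u.
have Sw : pdom S w by exact: uniform_simplex.
have u0 : 0 < u by rewrite invr_gt0 ltr0n.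
pose K := \sum_(j | j != i) `|ln u * (u - y 0 j)|.
have key s : 0 < s -> s <= 1 -> dotp g (w - y) <= K + u * ln s.
  move=> s0 s1; pose c := y + s *: (w - y).
  have Sc : pdom S c.
    by apply: (convex_set_seg simplex_convex Sy Sw); rewrite ltW.
  have cE j : c 0 j = y 0 j + s * (u - y 0 j) by rewrite !mxE.
  have c0 : positive c.
    move=> j; rewrite cE.
    have : 0 <= (1 - s) * y 0 j by rewrite mulr_ge0// subr_ge0.
    have : 0 < s * u by rewrite mulr_gt0.
    lra.
  have := entropy_subgradient Sc c0 Sy; have := hg _ Sc.
  have -> : c - y = s *: (w - y) by apply/rowP => j; rewrite !mxE; ring.
  have -> : y - c = - s *: (w - y) by apply/rowP => j; rewrite !mxE; ring.
  rewrite !dotpZr => h1 h2.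
  have h3 : dotp g (w - y) <= dotp (dH c) (w - y).
    by rewrite -(ler_pM2l s0); lra.
  apply: le_trans h3 _; rewrite dotp_dH// (bigD1 i)//= addrC lerD//; last first.
    rewrite cE yi mxE !subr0 add0r mulrC ler_pM2l// lnM ?posrE//.
    rewrite gerDl ln_le0// invf_le1 ?ltr0n// ler1n//.
  apply: ler_sum => j _; have -> : w 0 j = u by rewrite mxE.
  have cj1 := simplex_le1 j Sc.
  have [uy|yu] := leP (y 0 j) u.
    apply: le_trans (normr_ge0 _).
    by rewrite mulr_le0_ge0 ?ln_le0// subr_ge0.
  apply: le_trans (ler_norm _).
  apply: ler_wnM2r; first by rewrite subr_le0 ltW.
  rewrite ler_ln ?posrE// cE.
  have : 0 <= (1 - s) * (y 0 j - u) by rewrite mulr_ge0 ?subr_ge0// ltW.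
  lra.
(* Chosen so that [K + u * ln (expR (- t))] falls below [dotp g (w - y)]. *)
pose t := (`|K - dotp g (w - y)| + 1) / u.
have t0 : 0 <= t by rewrite divr_ge0 ?addr_ge0// ltW.
have := key (expR (- t)); rewrite expR_gt0 -[X in _ <= X]expR0 ler_expR.
rewrite expRK oppr_le0 t0 => /(_ isT isT).
rewrite mulrN /t mulrC divfK ?gt_eqF//.
have := ler_norm (K - dotp g (w - y)); lra.
Qed.

(** Minimality along [p + s (w - p)] gives
    [0 <= s * <a + dH p, w - p> + bregman p (p + s (w - p))], and the Bregman
    term is [O(s ^+ 2)] by [kl_le_chi2]. *)
Lemma entropy_optimality a p w : is_argmin (pdom S) (fun y => dotp a y + H y) p ->
  pdom S w -> 0 <= dotp (a + dH p) (w - p).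
Proof.
move=> [Sp hp] Sw.
have p0 : positive p.
  apply: pdomo_positive; split => //; exists (- a) => y Sy.
  by have := hp _ Sy; rewrite !dotp_lin; lra.
rewrite -oppr_le0.
apply: (@le0_of_small _ _ (\sum_i (w 0 i - p 0 i) ^+ 2 / p 0 i)).
move=> s /andP[s0 s1]; pose q := p + s *: (w - p).
have Sq : pdom S q.
  by apply: (convex_set_seg simplex_convex Sp Sw); rewrite !ltW.
have := hp _ Sq; have := kl_le_chi2 Sp p0 Sq.
rewrite /bregman (_ : q - p = s *: (w - p)); last first.
  by rewrite /q (addrC p) addrK.
have -> : \sum_i (q 0 i - p 0 i) ^+ 2 / p 0 i =
    s ^+ 2 * \sum_i (w 0 i - p 0 i) ^+ 2 / p 0 i.
  by rewrite mulr_sumr; apply: eq_bigr => i _; rewrite !mxE; ring.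
set K := \sum_i _; rewrite {3}/q !dotp_lin => h1 h2.
by rewrite -(ler_pM2l s0); lra.
Qed.

Lemma simplex_three_point z xi p w : is_prox S z xi p -> pdom S w ->
  dotp xi (p - w) <= bregman S z w - bregman S p w - bregman S z p.
Proof.
move=> [Sp hp] Sw.
have := @entropy_optimality (xi - dH z) p w.
rewrite /bregman !dotp_lin => h.
suff /h/(_ Sw) : is_argmin (pdom S) (fun y => dotp (xi - dH z) y + H y) p by lra.
by split => // y Sy; have := hp _ Sy; rewrite /bregman !dotp_lin; lra.
Qed.

(** Pinsker's inequality. *)
Lemma simplex_bregman_ge_half_sq z w : pdomo S z -> pdom S w ->
  pnorm S (w - z) ^+ 2 / 2 <= bregman S z w.
Proof.
move=> Zz Sw; have z0 := pdomo_positive Zz; have [Sz _] := Zz.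
have wE : w = z + (w - z) by rewrite addrC subrK.
rewrite {2}wE; apply: bregman_ge_half_sq_seg; [exact: is_norm_l1| |by rewrite -wE].
move=> s s01; set y := z + s *: (w - z).
have y0 : positive y by exact: positive_seg.
have Sy : pdom S y.
  by apply: (convex_set_seg simplex_convex Sz Sw); lra.
split => //; first exact: entropy_subgradient.
have -> : s *: (w - z) = y - z by rewrite /y (addrC z) addrK.
rewrite dotpBl !dotp_dH// -sumrB; set l := pnorm S (y - z).
have -> : l ^+ 2 = \sum_i (2 * l * `|y 0 i - z 0 i|
    - l ^+ 2 * ((y 0 i + z 0 i) / 2)).
  rewrite sumrB -!mulr_sumr -mulr_suml big_split/=.
  case: Sy => _ ->; case: Sz => _ ->.
  have -> : \sum_i `|y 0 i - z 0 i| = l.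
    by apply: eq_bigr => i _; rewrite !mxE.
  by field.
apply: ler_sum => i _; rewrite -mulrBl; exact: ln_sub_mono_weighted.
Qed.

(** The Bregman distance from the center is at most the oscillation of the
    negative entropy, which takes values between [- ln m] and 0. *)
Lemma simplex_center_width c y : is_center S c -> pdom S y ->
  bregman S c y <= ln m%:R.
Proof.
move=> hc Sy; have m0 := simplex_pos_dim Sy; have [Sc _] := hc.
have : 0 <= dotp (dH c) (y - c).
  rewrite -[dH c]add0r; apply: entropy_optimality => //; split => // q Sq.
  by rewrite !dotp0l !add0r; exact: (hc.2 _ Sq).
have Hy : H y <= 0.
  apply: sumr_le0 => i _; have [y0 _] := Sy.
  by rewrite mulr_ge0_le0// ln_le0// simplex_le1.
have Hc : - H c <= ln m%:R.
  have u0 : 0 < m%:R^-1 :> R by rewrite invr_gt0 ltr0n.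
  suff : \sum_i (c 0 i * ln m%:R^-1 - c 0 i * ln (c 0 i)) <= 0.
    rewrite sumrB -mulr_suml; case: Sc => _ ->.
    rewrite lnV ?posrE ?ltr0n// /=; lra.
  apply: (@le_trans _ _ (\sum_i (m%:R^-1 - c 0 i))); last first.
    have [_ u1] := uniform_simplex m0; have [_ c1] := Sc.
    rewrite sumrB c1 -[X in _ - X]u1 subr_le0; apply: ler_sum => i _.
    by rewrite mxE.
  by apply: ler_sum => i _; apply: mul_ln_tangent => //; case: Sc.
rewrite /bregman; lra.
Qed.

End Simplex.

(** * Dual norms *)
Section DualNorm.
Context {R : realType} {n : nat} (N : 'rV[R]_n -> R) (hN : is_norm N).
Implicit Types u v z zeta : 'rV[R]_n.

Lemma is_norm_le_supnorm : exists2 K, 0 < K & forall z, N z <= K * `|z|.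
Proof.
exists (\sum_i N (delta_mx 0 i) + 1).
  by rewrite ltr_wpDl// sumr_ge0// => i _; exact: is_norm_ge0.
move=> z; apply: (@le_trans _ _ (\sum_i N (z 0 i *: delta_mx 0 i))).
  rewrite {1}(row_sum_delta z).
  apply: (big_ind2 (fun a b => N a <= b)) => //.
    by rewrite is_norm0.
  move=> a b c d ab cd; apply: le_trans (is_norm_triangle hN _ _) _.
  exact: lerD.
rewrite mulrDl mul1r ler_wpDr// mulr_suml; apply: ler_sum => i _.
by rewrite (is_norm_scale hN) mulrC ler_wpM2l ?is_norm_ge0// coord_le_norm.
Qed.

Lemma is_norm_continuous : continuous N.
Proof.
have [K K0 hK] := is_norm_le_supnorm.
move=> z; have FF : Filter (nbhs z) := @nbhs_filter _ z.
apply/(@cvgrPdist_le _ _ _ (nbhs z) FF) => e e0.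
apply/nbhs_ballP; exists (e / K); first by rewrite /= divr_gt0.
move=> w; rewrite -ball_normE/= => /ltW zw; apply: (@le_trans _ _ (N (z - w))).
  have := is_norm_triangle hN (z - w) w; have := is_norm_triangle hN (w - z) z.
  rewrite !subrK (is_norm_distC hN w z) ler_norml; lra.
by apply: le_trans (hK _) _; rewrite mulrC -ler_pdivlMr.
Qed.

(** The supremum that defines a dual norm is meaningful only if the unit ball
    of [N] is bounded; this is the equivalence of norms in finite dimension, by
    compactness of the sphere. *)
Lemma supnorm_le_is_norm : exists2 c, 0 < c & forall z, c * `|z| <= N z.
Proof.
pose Sph := [set z : 'rV[R]_n | `|z| = 1].
have cSph : compact Sph.
  apply: bounded_closed_compact.
    exists 1; split => // x x1 z; rewrite /Sph/= => ->; exact: ltW.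
  apply: (@closed_comp _ _ (fun z : 'rV[R]_n => `|z|) [set x | x = 1]).
    by move=> z _; exact: norm_continuous.
  exact: closed_eq.
have [Sph0|Sph0] := pselect (Sph !=set0); last first.
  exists 1 => // z; have [->|z0] := eqVneq z 0.
    by rewrite normr0 mulr0 is_norm0.
  exfalso; apply: Sph0; exists (`|z|^-1 *: z).
  by rewrite /Sph/= normrZ normfV normr_id mulVf// normr_eq0.
have cN : {within Sph, continuous N}.
  by apply: continuous_subspaceT; exact: is_norm_continuous.
have [z0 /set_mem z01 hz0] := EVT_min_rV Sph0 cSph cN.
have Nz0 : 0 < N z0.
  rewrite lt_neqAle is_norm_ge0// andbT eq_sym; apply/eqP => /(is_norm_eq0 hN).
  by move=> z00; move: z01; rewrite /Sph/= z00 normr0 => /esym/eqP; rewrite oner_eq0.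
exists (N z0) => // z; have [->|zn0] := eqVneq z 0.
  by rewrite normr0 mulr0 is_norm0.
have nz : 0 < `|z| by rewrite normr_gt0.
have /hz0 : (`|z|^-1 *: z) \in Sph.
  by apply/mem_set; rewrite /Sph/= normrZ normfV normr_id mulVf// normr_eq0.
by rewrite (is_norm_scale hN) normfV normr_id mulrC ler_pdivlMr.
Qed.

Lemma dual_norm_has_ubound zeta :
  has_ubound [set dotp zeta z | z in [set z | N z <= 1]].
Proof.
have [c c0 hc] := supnorm_le_is_norm.
exists ((\sum_i `|zeta 0 i|) * c^-1) => _ [z /= Nz <-].
rewrite dotpC; apply: le_trans (dotp_le_supnorm _ _) _.
rewrite mulrC ler_wpM2l ?sumr_ge0//.
by rewrite -[leRHS]mul1r ler_pdivlMr// mulrC (le_trans (hc z)).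
Qed.

Lemma dual_norm_ge0 zeta : 0 <= dual_norm N zeta.
Proof.
apply: ub_le_sup; first exact: dual_norm_has_ubound.
by exists 0; rewrite ?dotp0r//= is_norm0.
Qed.

Lemma dotp_le_dual_norm zeta z : dotp zeta z <= dual_norm N zeta * N z.
Proof.
have [->|z0] := eqVneq z 0; first by rewrite dotp0r is_norm0// mulr0.
have Nz : 0 < N z.
  rewrite lt_neqAle is_norm_ge0// andbT eq_sym.
  by apply: contra z0 => /eqP/(is_norm_eq0 hN)->.
rewrite -ler_pdivrMr// mulrC -dotpZr; apply: ub_le_sup.
  exact: dual_norm_has_ubound.
exists ((N z)^-1 *: z) => //=.
by rewrite (is_norm_scale hN) gtr0_norm ?invr_gt0// mulVf// gt_eqF.
Qed.

Lemma dotp_le_of_dual_norm zeta z G : dual_norm N zeta <= G ->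
  dotp zeta z <= G * N z.
Proof.
move=> hG; apply: le_trans (dotp_le_dual_norm _ _) _.
by rewrite ler_wpM2r// is_norm_ge0.
Qed.

End DualNorm.

(** * Prox steps and mirror-prox steps *)

(** The two inequalities through which prox steps are analysed.  They are kept
    apart from [proximal_setup] so that the simplex, whose gradient blows up at
    the boundary, and the joint setup share the analysis. *)
Record bregman_regular (R : realType) (n : nat) (P : prox_data R n) : Prop :=
  BregmanRegular {
  regular_three_point : forall z xi p w, is_prox P z xi p -> pdom P w ->
    dotp xi (p - w) <= bregman P z w - bregman P p w - bregman P z p ;
  regular_half_sq : forall z w, pdomo P z -> pdom P w ->
    pnorm P (w - z) ^+ 2 / 2 <= bregman P z w }.

Lemma setup_regular (R : realType) (n : nat) (P : prox_data R n) :
  proximal_setup P -> bregman_regular P.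
Proof.
by move=> hP; split=> *; [exact: prox_three_point | exact: bregman_ge_half_sq].
Qed.

Lemma simplex_regular (R : realType) (m : nat) :
  bregman_regular (simplex_data R m).
Proof.
by split=> *; [exact: simplex_three_point | exact: simplex_bregman_ge_half_sq].
Qed.

Section ProxSteps.
Context {R : realType} {n : nat} (P : prox_data R n) (rP : bregman_regular P).
Implicit Types g v w z xi : 'rV[R]_n.

Lemma bregman_ge0 z w : pdomo P z -> pdom P w -> 0 <= bregman P z w.
Proof.
move=> Zz Zw; apply: le_trans (regular_half_sq rP Zz Zw).
by rewrite divr_ge0// sqr_ge0.
Qed.

(** The distance moved is paid for by the quadratic lower bound:
    [eta * G * N d - N d ^+ 2 / 2 <= (eta * G) ^+ 2 / 2]. *)
Lemma prox_step v g eta G v' w : pdomo P v -> 0 < eta ->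
  is_prox P v (- eta *: g) v' -> dotp g (v' - v) <= G * pnorm P (v' - v) ->
  pdom P w ->
  dotp g (w - v) <= (bregman P v w - bregman P v' w) / eta + eta * G ^+ 2 / 2.
Proof.
move=> Zv eta0 hv' hG Zw; have Zv' : pdom P v' by case: hv'.
have h1 := regular_three_point rP hv' Zw.
have h2 := regular_half_sq rP Zv Zv'.
have h3 := sqr_ge0 (eta * G - pnorm P (v' - v)).
have := ler_wpM2l (ltW eta0) hG; move: h1 h2 h3.
rewrite !dotp_lin; set a := pnorm P _ => h1 h2 h3 h4.
have : (eta * G - a) ^+ 2 = eta * (eta * G ^+ 2) - 2 * (eta * (G * a)) + a ^+ 2.
  by ring.
move=> h5; rewrite -(ler_pM2l eta0).
have -> : eta * ((bregman P v w - bregman P v' w) / eta + eta * G ^+ 2 / 2) =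
    bregman P v w - bregman P v' w + eta * (eta * G ^+ 2) / 2.
  by field; rewrite gt_eqF.
lra.
Qed.

(** The extragradient step.  Adding the three-point inequalities of both prox
    steps leaves the error [<xi2 - xi1, z - v'>], which the Lipschitz condition
    makes smaller than the two Bregman distances that appear with a negative
    sign. *)
Lemma mirror_prox_step v xi1 xi2 z v' w : pdomo P v ->
  is_prox P v xi1 z -> is_prox P v xi2 v' ->
  dotp (xi2 - xi1) (z - v') <=
    (pnorm P (z - v) ^+ 2 + pnorm P (v' - z) ^+ 2) / 2 ->
  pdom P w -> dotp xi2 (z - w) <= bregman P v w - bregman P v' w.
Proof.
move=> Zv hz hv' hL Zw.
have Zv' : pdom P v' by case: hv'.
have Zz : pdom P z by case: hz.
have := regular_three_point rP hz Zv'; have := regular_three_point rP hv' Zw.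
have := regular_half_sq rP Zv Zz.
have := regular_half_sq rP (is_prox_pdomo hz) Zv'.
move: hL; rewrite !dotp_lin; lra.
Qed.

End ProxSteps.

(** * The joint setup on a product *)
Lemma argmin_ext (R : realType) (d : nat) (Z : set 'rV[R]_d)
    (h h' : 'rV[R]_d -> R) z :
  h =1 h' -> is_argmin Z h z -> is_argmin Z h' z.
Proof. by move=> /funext ->. Qed.

Lemma argmin_scale (R : realType) (d : nat) (Z : set 'rV[R]_d)
    (h h' : 'rV[R]_d -> R) b z : 0 < b -> (forall q, h q = b * h' q) ->
  is_argmin Z h z -> is_argmin Z h' z.
Proof.
move=> b0 hh' [Zz hz]; split => // q Zq.
by have := hz q Zq; rewrite !hh' ler_pM2l.
Qed.

Section Joint.
Context {R : realType} {n m : nat} (PX : prox_data R n) (PY : prox_data R m).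
Context (bX bY : R) (bX0 : 0 < bX) (bY0 : 0 < bY).
Local Notation P := (joint_data bX bY PX PY).
Implicit Types v w z xi : 'rV[R]_(n + m).

Lemma joint_bregman v w : bregman P v w =
  bX * bregman PX (lsubmx v) (lsubmx w) + bY * bregman PY (rsubmx v) (rsubmx w).
Proof.
rewrite /bregman dotp_row_mx/= row_mxKl row_mxKr !dotpZl lsubmxB rsubmxB.
ring.
Qed.

Lemma joint_pnorm_sqr v : pnorm P v ^+ 2 =
  bX * pnorm PX (lsubmx v) ^+ 2 + bY * pnorm PY (rsubmx v) ^+ 2.
Proof.
by rewrite /= sqr_sqrtr// addr_ge0// mulr_ge0 ?sqr_ge0// ltW.
Qed.

Lemma argmin_split (hX : 'rV[R]_n -> R) (hY : 'rV[R]_m -> R) z :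
  is_argmin (pdom P) (fun v => hX (lsubmx v) + hY (rsubmx v)) z ->
  is_argmin (pdom PX) hX (lsubmx z) /\ is_argmin (pdom PY) hY (rsubmx z).
Proof.
move=> [[Xz Yz] hz]; split; split=> // q Zq.
- have := hz (row_mx q (rsubmx z)); rewrite /= row_mxKl row_mxKr lerD2r.
  by apply.
- have := hz (row_mx (lsubmx z) q); rewrite /= row_mxKl row_mxKr lerD2l.
  by apply.
Qed.

Lemma joint_center z : is_center P z ->
  is_center PX (lsubmx z) /\ is_center PY (rsubmx z).
Proof.
move=> hz.
have [hX hY] := @argmin_split (fun x => bX * dgf PX x) (fun y => bY * dgf PY y) z hz.
by split; [apply: argmin_scale hX; first exact: bX0
          |apply: argmin_scale hY; first exact: bY0].
Qed.

Lemma joint_prox v xi z : is_prox P v xi z ->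
  is_prox PX (lsubmx v) (bX^-1 *: lsubmx xi) (lsubmx z) /\
  is_prox PY (rsubmx v) (bY^-1 *: rsubmx xi) (rsubmx z).
Proof.
move=> hz.
pose hX x := dotp (lsubmx xi) x + bX * bregman PX (lsubmx v) x.
pose hY y := dotp (rsubmx xi) y + bY * bregman PY (rsubmx v) y.
have [zX zY] : is_argmin (pdom PX) hX (lsubmx z) /\
    is_argmin (pdom PY) hY (rsubmx z).
  apply: argmin_split; apply: argmin_ext hz => w.
  rewrite joint_bregman dotp_row_mx /hX /hY; ring.
split.
- apply: argmin_scale zX; first exact: bX0.
  by move=> q; rewrite /hX /hY dotpZl; field; rewrite gt_eqF.
- apply: argmin_scale zY; first exact: bY0.
  by move=> q; rewrite /hX /hY dotpZl; field; rewrite gt_eqF.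
Qed.

Lemma joint_pdomo v : pdomo P v -> pdomo PX (lsubmx v) /\ pdomo PY (rsubmx v).
Proof.
move=> [[Xv Yv] [g hg]]; split; split => //.
- exists (bX^-1 *: lsubmx g) => q Zq.
  have := hg (row_mx q (rsubmx v)); rewrite dotp_row_mx/= lsubmxB rsubmxB.
  rewrite row_mxKl row_mxKr subrr dotp0r addr0 => /(_ (conj Zq Yv)) h.
  by rewrite -(ler_pM2l bX0) mulrDr dotpZl mulVKf ?gt_eqF//; lra.
- exists (bY^-1 *: rsubmx g) => q Zq.
  have := hg (row_mx (lsubmx v) q); rewrite dotp_row_mx/= lsubmxB rsubmxB.
  rewrite row_mxKl row_mxKr subrr dotp0r add0r => /(_ (conj Xv Zq)) h.
  by rewrite -(ler_pM2l bY0) mulrDr dotpZl mulVKf ?gt_eqF//; lra.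
Qed.

Lemma joint_regular : bregman_regular PX -> bregman_regular PY ->
  bregman_regular P.
Proof.
move=> rX rY; split.
- move=> z xi p w /joint_prox[hX hY] [Xw Yw].
  have := regular_three_point rX hX Xw; have := regular_three_point rY hY Yw.
  rewrite !dotpZl !joint_bregman dotp_row_mx.
  rewrite !lsubmxB !rsubmxB.
  rewrite mulrC ler_pdivrMr// => h1; rewrite mulrC ler_pdivrMr// => h2.
  lra.
- move=> z w /joint_pdomo[Xz Yz] [Xw Yw].
  have := regular_half_sq rX Xz Xw; have := regular_half_sq rY Yz Yw.
  rewrite joint_bregman joint_pnorm_sqr.
  rewrite !lsubmxB !rsubmxB.
  move=> /(ler_wpM2l (ltW bY0)) h1 /(ler_wpM2l (ltW bX0)) h2; lra.
Qed.

End Joint.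

(** * Weights and weighted averages *)
Section Weights.
Context {R : realType}.

Lemma thetaE (T t : nat) : theta R T t = 2 / (T%:R * T.+1%:R) * t%:R.
Proof. by rewrite /theta !natrM; ring. Qed.

Lemma theta_gt0 (T t : nat) : (0 < T)%N -> (0 < t)%N -> 0 < theta R T t.
Proof. by move=> T0 t0; rewrite divr_gt0// ltr0n muln_gt0 ?T0 ?t0. Qed.

Lemma theta_le (T t : nat) : (t <= T)%N -> (0 < T)%N ->
  theta R T t <= 2 / T.+1%:R.
Proof.
move=> tT T0; have T0' : 0 < T%:R :> R by rewrite ltr0n.
have -> : 2 / T.+1%:R = theta R T T.
  by rewrite thetaE; field; rewrite ?gt_eqF// ltr0n.
rewrite !thetaE.
by apply: ler_wpM2l; [rewrite divr_ge0// mulr_ge0 | rewrite ler_nat].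
Qed.

Lemma sup_theta (T : nat) : (0 < T)%N ->
  sup [set theta R T s | s in [set s : nat | (1 <= s <= T)%N]] = 2 / T.+1%:R.
Proof.
move=> T0; have T0' : 0 < T%:R :> R by rewrite ltr0n.
have thT : theta R T T = 2 / T.+1%:R.
  by rewrite thetaE; field; rewrite ?gt_eqF// ltr0n.
have ub : ubound [set theta R T s | s in [set s : nat | (1 <= s <= T)%N]]
    (2 / T.+1%:R).
  move=> _ [s /= /andP[_ sT] <-]; exact: theta_le.
apply/eqP; rewrite eq_le; apply/andP; split.
  by apply: ge_sup ub; exists (theta R T T), T => //=; rewrite T0 leqnn.
rewrite -{1}thT; apply: ub_le_sup; first by exists (2 / T.+1%:R).
by exists T => //=; rewrite T0 leqnn.
Qed.

Lemma sum_theta (T : nat) : (0 < T)%N ->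
  \sum_(1 <= t < T.+1) theta R T t = 1.
Proof.
move=> T0.
have h (j : nat) : \sum_(1 <= t < j.+1) t%:R = j%:R * j.+1%:R / 2 :> R.
  elim: j => [|j IH]; first by rewrite big_nil !mul0r.
  by rewrite big_nat_recr//= IH -(natr1 j.+1) -(natr1 j); field.
under eq_bigr => t _ do rewrite thetaE.
rewrite -mulr_sumr h; field.
by rewrite !gt_eqF ?ltr0n.
Qed.

(** By induction on the number of points, the new average being a convex
    combination of the old one and the last point; positive weights keep the
    partial sums invertible. *)
Lemma jensen_nat (n : nat) (Z : set 'rV[R]_n) (h : 'rV[R]_n -> R)
    (a : nat -> R) (x : nat -> 'rV[R]_n) (T : nat) :
  convex_set Z -> convex_function Z h ->
  (forall t, (1 <= t <= T.+1)%N -> 0 < a t /\ Z (x t)) ->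
  let A := \sum_(1 <= t < T.+2) a t in
  let xbar := A^-1 *: \sum_(1 <= t < T.+2) a t *: x t in
  [/\ 0 < A, Z xbar & h xbar <= A^-1 * \sum_(1 <= t < T.+2) a t * h (x t)].
Proof.
move=> cZ ch; elim: T => [|T IH] hax /=.
  have [a0 Zx] := hax 1%N isT.
  rewrite !big_nat1 scalerA mulrA mulVf ?gt_eqF// scale1r mul1r.
  by split.
have [|A0 Zb hb] := IH _; first by move=> t /andP[t1 tT]; apply: hax; rewrite t1 ltnW.
have [a0 Zx] := hax T.+2 (leqnn _).
rewrite !(big_nat_recr T.+2)//=.
move: A0 Zb hb; set A := \sum_(1 <= t < T.+2) a t.
set X := \sum_(1 <= t < T.+2) a t *: x t.
set H := \sum_(1 <= t < T.+2) a t * h (x t) => A0 Zb hb.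
have AA : 0 < A + a T.+2 by rewrite addr_gt0.
pose s := a T.+2 / (A + a T.+2).
have s01 : 0 <= s <= 1.
  apply/andP; split; first by rewrite divr_ge0// ltW.
  by rewrite ler_pdivrMr// mul1r lerDr ltW.
have xE : (A + a T.+2)^-1 *: (X + a T.+2 *: x T.+2) =
    A^-1 *: X + s *: (x T.+2 - A^-1 *: X).
  by apply/rowP => i; rewrite !mxE /s; field; rewrite !gt_eqF.
split => //; rewrite xE; first exact: convex_set_seg.
apply: le_trans (convex_function_seg ch Zb Zx s01) _.
have s1 : 0 <= 1 - s by lra.
have -> : (A + a T.+2)^-1 * (H + a T.+2 * h (x T.+2)) =
    (1 - s) * (A^-1 * H) + s * h (x T.+2).
  by rewrite /s; field; rewrite !gt_eqF.
have := ler_wpM2l s1 hb; lra.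
Qed.

End Weights.

(** * Regret of the uncertainty players *)
Section Uncertainty.
Context {R : realType} {d : nat} (P : prox_data R d) (hP : proximal_setup P).
Context (al GU : R) (al0 : 0 < al).

(** The sum rule for [h = - phi - al' omega]: subtracting [al' * omega] from
    [- phi] moves the subgradient by the gradient of [omega], which produces
    the Bregman distance. *)
Lemma concave_upper_bound (phi : 'rV[R]_d -> R) (al' : R) g u w :
  al <= al' ->
  convex_function (pdom P) (fun y => - phi y - al' * dgf P y) ->
  is_supergradient (pdom P) phi u g -> pdomo P u -> pdom P w ->
  phi w - phi u <= dotp g (w - u) - al * bregman P u w.
Proof.
move=> alal' cphi hg Zu Zw.
have al'0 : 0 <= al' by rewrite (le_trans _ alal')// ltW.
have sub : is_subgradient (pdom P)
    (fun y => (- phi y - al' * dgf P y) + al' * dgf P y) u (- g).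
  by move=> y Zy; have := hg y Zy; rewrite dotpNl; lra.
have := subgradient_sum_rule hP al'0 cphi Zu sub Zw.
have := bregman_ge0 (setup_regular hP) Zu Zw => V0.
have := ler_wpM2r V0 alal'; rewrite /bregman !dotp_lin; lra.
Qed.

(** Write [V_t] for the Bregman distance from [u t] to [w].  At step [t] the
    inverse step size [al * (t + 1) / 2] multiplies [V_t - V_{t+1}], and strong
    concavity lowers the coefficient of [V_t] to [al * (t - 1) / 2].  After
    multiplication by [t], which is the weight [theta R T t] up to
    normalization, the coefficients of [V_{t+1}] at the steps [t] and [t + 1]
    cancel. *)
Lemma strongly_concave_regret (phi : nat -> 'rV[R]_d -> R) (al' : R)
    (g u : nat -> 'rV[R]_d) (T : nat) w :
  al <= al' -> is_center P (u 1%N) -> (0 < T)%N ->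
  (forall t, (1 <= t <= T)%N -> pdom P (u t) -> [/\
    convex_function (pdom P) (fun y => - phi t y - al' * dgf P y),
    is_supergradient (pdom P) (phi t) (u t) (g t),
    dual_norm (pnorm P) (g t) <= GU &
    is_prox P (u t) (- (2 / (al * t.+1%:R)) *: g t) (u t.+1)]) ->
  pdom P w ->
  \sum_(1 <= t < T.+1) theta R T t * (phi t w - phi t (u t)) <=
    2 * GU ^+ 2 / (al * T.+1%:R).
Proof.
move=> alal' hu1 T0 ht Zw.
have hN := setup_norm hP; have rP := setup_regular hP.
have Zu t : (t < T.+1)%N -> pdomo P (u t.+1).
  elim: t => [_|t IH tT]; first exact: is_center_pdomo.
  have [Zut _] := IH (ltnW tT).
  have [|_ _ _] := ht t.+1 _ Zut; first by [].
  exact: is_prox_pdomo.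
have step t : (t < T)%N -> t.+1%:R * (phi t.+1 w - phi t.+1 (u t.+1)) <=
    al / 2 * (t%:R * t.+1%:R * bregman P (u t.+1) w
      - t.+1%:R * t.+2%:R * bregman P (u t.+2) w) + GU ^+ 2 / al.
  move=> tT; have Zut := Zu t (ltnW tT); have [Zut' _] := Zut.
  have [|cphi hg hG hprox] := ht t.+1 _ Zut'; first by [].
  have h1 := concave_upper_bound alal' cphi hg Zut Zw.
  have t2 : 0 < t.+2%:R :> R by rewrite ltr0n.
  have eta0 : 0 < 2 / (al * t.+2%:R) by rewrite divr_gt0// mulr_gt0.
  have h2 := prox_step rP Zut eta0 hprox
    (dotp_le_of_dual_norm hN (u t.+2 - u t.+1) hG) Zw.
  set V := bregman P _ w in h1 h2 *; set V' := bregman P _ w in h2 *.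
  have h3 : phi t.+1 w - phi t.+1 (u t.+1) <=
      (V - V') / (2 / (al * t.+2%:R)) + 2 / (al * t.+2%:R) * GU ^+ 2 / 2 - al * V.
    by apply: (le_trans h1); rewrite lerD2r.
  have t10 : 0 <= t.+1%:R :> R by [].
  apply: le_trans (ler_wpM2l t10 h3) _.
  have h4 : t.+1%:R / t.+2%:R * (GU ^+ 2 / al) <= GU ^+ 2 / al.
    apply: ler_piMl; first by rewrite divr_ge0 ?sqr_ge0// ltW.
    by rewrite ler_pdivrMr// mul1r ler_nat.
  apply: le_trans (lerD (lexx _) h4).
  rewrite le_eqVlt; apply/orP; left; apply/eqP.
  rewrite -(natr1 t.+1) -(natr1 t); field.
  by rewrite natr1 natr1 !gt_eqF.
have sum (j : nat) : (j <= T)%N ->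
    \sum_(1 <= t < j.+1) t%:R * (phi t w - phi t (u t)) <=
    j%:R * (GU ^+ 2 / al) - al / 2 * (j%:R * j.+1%:R * bregman P (u j.+1) w).
  elim: j => [_|j IH jT]; first by rewrite big_nil !mul0r mulr0 subrr.
  rewrite big_nat_recr//=; have := IH (ltnW jT); have := step j jT.
  rewrite -(natr1 j.+1) -(natr1 j); lra.
have := sum T (leqnn T).
have V0 : 0 <= al / 2 * (T%:R * T.+1%:R * bregman P (u T.+1) w).
  apply: mulr_ge0; first by rewrite divr_ge0// ltW.
  by apply: mulr_ge0; [rewrite mulr_ge0 | apply: (bregman_ge0 rP); first exact: Zu].
move=> hs; have {}hs : \sum_(1 <= t < T.+1) t%:R * (phi t w - phi t (u t)) <=
  T%:R * (GU ^+ 2 / al) by lra.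
under eq_bigr => t _ do rewrite thetaE -(mulrA (2 / _)).
have T0' : 0 < T%:R :> R by rewrite ltr0n.
rewrite -mulr_sumr; apply: le_trans (ler_wpM2l _ hs) _.
  by rewrite divr_ge0// mulr_ge0.
rewrite le_eqVlt; apply/orP; left; apply/eqP; field.
by rewrite !gt_eqF ?ltr0n.
Qed.

End Uncertainty.

(** * The saddle-point gap of mirror-prox *)
Section SaddlePoint.
Context {R : realType} {OmX GX LX : R} {n m : nat} {k : 'I_m -> nat}.
Context {PX : prox_data R n} {PU : forall i : 'I_m, prox_data R (k i)}.
Context {f : forall i : 'I_m, 'rV[R]_n -> 'rV[R]_(k i) -> R}.
Context {gx : forall i : 'I_m, 'rV[R]_n -> 'rV[R]_(k i) -> 'rV[R]_n}.
Arguments f : clear implicits.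
Arguments gx : clear implicits.
Context (OmX0 : 0 < OmX) (GX0 : 0 < GX) (LX0 : 0 <= LX) (m2 : (2 <= m)%N).
Context (sX : proximal_setup PX) (wX : is_width PX OmX).
Context (hgx : forall i x ui, pdom PX x -> pdom (PU i) ui ->
  is_subgradient (pdom PX) (f i ^~ ui) x (gx i x ui)).
Context (hGX : forall i x ui, pdom PX x -> pdom (PU i) ui ->
  dual_norm (pnorm PX) (gx i x ui) <= GX).
Context (hLX : forall i ui x x', pdom (PU i) ui -> pdom PX x -> pdom PX x' ->
  dual_norm (pnorm PX) (gx i x ui - gx i x' ui) <= LX * pnorm PX (x - x')).
Local Notation Y := (simplex_data R m).
Local Notation J := (joint_setup OmX GX LX m PX).
Local Notation L := (LXY OmX GX LX m).
Local Notation bX := (sigmaX OmX GX LX m / OmX).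
Local Notation bY := (sigmaY OmX GX LX m / ln m%:R).
Let S := Num.sqrt (OmX * ln m%:R).
Let hN := setup_norm sX.

Lemma ln_m_gt0 : 0 < ln m%:R :> R.
Proof. by rewrite ln_gt0// ltr1n. Qed.

Let S0 : 0 < S.
Proof. by rewrite sqrtr_gt0 mulr_gt0// ln_m_gt0. Qed.

Let SS : S * S = OmX * ln m%:R.
Proof. by rewrite -expr2 sqr_sqrtr// mulr_ge0 ?ltW// ln_m_gt0. Qed.

Lemma LXY_gt0 : 0 < L.
Proof.
rewrite /LXY ltr_wpDl//; first by rewrite mulr_ge0// ltW.
by rewrite !mulr_gt0.
Qed.

Lemma bX_gt0 : 0 < bX.
Proof.
rewrite divr_gt0// divr_gt0 ?LXY_gt0// ltr_wpDl//.
  by rewrite mulr_ge0// ltW.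
by rewrite mulr_gt0.
Qed.

Lemma bY_gt0 : 0 < bY.
Proof. by rewrite divr_gt0 ?ln_m_gt0// divr_gt0 ?LXY_gt0// mulr_gt0. Qed.

Lemma joint_setup_regular : bregman_regular J.
Proof.
apply: joint_regular; [exact: bX_gt0|exact: bY_gt0| |exact: simplex_regular].
exact: setup_regular.
Qed.

(** The weights are normalized by the widths: [bX * OmX + bY * ln m] is
    [sigmaX + sigmaY = 1]. *)
Lemma joint_center_width v w : is_center J v -> pdom J w -> bregman J v w <= 1.
Proof.
move=> hv [Xw Yw]; have [cX cY] := joint_center bX_gt0 bY_gt0 hv.
rewrite joint_bregman.
have hX : bregman PX (lsubmx v) (lsubmx w) <= OmX.
  by have [zc [hzc hOm _]] := wX; rewrite (center_unique sX cX hzc); exact: hOm.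
have hY := simplex_center_width cY Yw.
apply: le_trans (lerD (ler_wpM2l (ltW bX_gt0) hX) (ler_wpM2l (ltW bY_gt0) hY)) _.
rewrite !divfK ?gt_eqF ?ln_m_gt0// /sigmaX /sigmaY -mulrDl.
rewrite ler_pdivrMr ?LXY_gt0// /LXY; lra.
Qed.

Lemma payoff_lipschitz i ui x x' : pdom (PU i) ui -> pdom PX x -> pdom PX x' ->
  `|f i x ui - f i x' ui| <= GX * pnorm PX (x - x').
Proof.
move=> Ui Xx Xx'.
have h1 := dotp_le_of_dual_norm hN (x - x') (hGX Xx Ui).
have h2 := dotp_le_of_dual_norm hN (x' - x) (hGX Xx' Ui).
have := hgx Xx Ui Xx'; have := hgx Xx' Ui Xx.
rewrite (is_norm_distC hN x' x) in h2.
rewrite ler_norml; move: h1 h2; rewrite !dotp_lin => *; lra.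
Qed.

(** Writing [a, b] for the distances of the two components from [v] to [z] and
    [a', b'] for those from [v'] to [z], the left-hand side is at most
    [LX a a' + GX b a' + GX a b'].  Young's inequality with the ratio
    [p = sqrt (ln m / OmX)] and [q = 1 / p] balances the cross terms, and
    [L * bX = LX + GX p], [L * bY = GX q]. *)
Lemma Fop_smooth (u : forall i : 'I_m, 'rV[R]_(k i)) v z v' :
  (forall i, pdom (PU i) (u i)) -> pdom J v -> pdom J z -> pdom J v' ->
  dotp (Fop f gx u z - Fop f gx u v) (z - v') <=
    L * ((pnorm J (z - v) ^+ 2 + pnorm J (v' - z) ^+ 2) / 2).
Proof.
move=> hu [Xv Yv] [Xz Yz] [Xv' Yv'].
rewrite !(joint_pnorm_sqr _ _ bX_gt0 bY_gt0) dotp_row_mx.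
rewrite !lsubmxB !rsubmxB /Fop !row_mxKl !row_mxKr.
rewrite (is_norm_distC hN (lsubmx v')) (is_norm_distC (@is_norm_l1 R m) (rsubmx v')).
set zx := lsubmx z; set vx := lsubmx v; set v'x := lsubmx v'.
set zy := rsubmx z; set vy := rsubmx v; set v'y := rsubmx v'.
set a := pnorm PX (zx - vx); set a' := pnorm PX (zx - v'x).
set b := pnorm Y (zy - vy); set b' := pnorm Y (zy - v'y).
have a0 : 0 <= a by exact: is_norm_ge0.
have a'0 : 0 <= a' by exact: is_norm_ge0.
have hX : dotp (\sum_i zy 0 i *: gx i zx (u i) - \sum_i vy 0 i *: gx i vx (u i))
    (zx - v'x) <= LX * a * a' + GX * b * a'.
  rewrite -sumrB dotp_suml.
  apply: (@le_trans _ _ (\sum_i (zy 0 i * (LX * a * a') +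
      `|zy 0 i - vy 0 i| * (GX * a')))); last first.
    rewrite big_split/= -!mulr_suml; case: Yz => _ ->; rewrite mul1r.
    rewrite (_ : \sum_i _ = b); first lra.
    by apply: eq_bigr => i _; rewrite !mxE.
  apply: ler_sum => i _.
  have -> : zy 0 i *: gx i zx (u i) - vy 0 i *: gx i vx (u i) =
      zy 0 i *: (gx i zx (u i) - gx i vx (u i))
      + (zy 0 i - vy 0 i) *: gx i vx (u i).
    by apply/rowP => j; rewrite !mxE; ring.
  rewrite dotpDl !dotpZl; apply: lerD.
    case: Yz => zy0 _; apply: ler_wpM2l; first exact: zy0.
    exact: (dotp_le_of_dual_norm hN _ (hLX (hu i) Xz Xv)).
  apply: le_trans (ler_norm _) _; rewrite normrM ler_wpM2l//.
  have h1 := dotp_le_of_dual_norm hN (zx - v'x) (hGX Xv (hu i)).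
  have h2 := dotp_le_of_dual_norm hN (v'x - zx) (hGX Xv (hu i)).
  rewrite (is_norm_distC hN v'x zx) in h2.
  rewrite ler_norml; move: h1 h2; rewrite -/a' !dotp_lin => h1 h2; lra.
have hY : dotp (- (\row_i f i zx (u i)) - - (\row_i f i vx (u i))) (zy - v'y) <=
    GX * a * b'.
  rewrite dotpE mulr_sumr; apply: ler_sum => i _; rewrite !mxE.
  apply: le_trans (ler_norm _) _; rewrite normrM ler_wpM2r//.
  by rewrite -opprD normrN; exact: payoff_lipschitz.
apply: le_trans (lerD hX hY) _.
have LbX : L * bX = LX + GX * (S / OmX).
  rewrite /sigmaX -/S; field; rewrite !gt_eqF//; exact: LXY_gt0.
have LbY : L * bY = GX * (S / ln m%:R).
  rewrite /sigmaY -/S; field.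
  by rewrite !gt_eqF ?ln_m_gt0 ?LXY_gt0.
set p := S / OmX in LbX; set q := S / ln m%:R in LbY.
have pq : p * q = 1.
  rewrite /p /q mulrACA SS -invfM divff//.
  by rewrite mulf_neq0// gt_eqF// ln_m_gt0.
have p0 : 0 < p by rewrite divr_gt0.
have -> : L * ((bX * a ^+ 2 + bY * b ^+ 2 + (bX * a' ^+ 2 + bY * b' ^+ 2)) / 2)
    = ((L * bX) * (a ^+ 2 + a' ^+ 2) + (L * bY) * (b ^+ 2 + b' ^+ 2)) / 2.
  by ring.
rewrite LbX LbY.
have young c e : 2 * (c * e) <= p * c ^+ 2 + q * e ^+ 2.
  rewrite -(ler_pM2l p0) mulrDr (mulrA p q) pq mul1r.
  have := sqr_ge0 (p * c - e).
  rewrite (_ : (p * c - e) ^+ 2 =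
    p * (p * c ^+ 2) + e ^+ 2 - p * (2 * (c * e))); last by ring.
  lra.
have h1 := ler_wpM2l (ltW GX0) (young a' b).
have h2 := ler_wpM2l (ltW GX0) (young a b').
have h3 := ler_wpM2l LX0 (sqr_ge0 (a - a')).
rewrite sqrrB in h3; lra.
Qed.

Context {T : nat} (T0 : (0 < T)%N).
Context {u : nat -> forall i : 'I_m, 'rV[R]_(k i)}.
Context {v z : nat -> 'rV[R]_(n + m)}.
Context (hu : forall t i, (1 <= t <= T)%N -> pdom (PU i) (u t i)).
Context (hv1 : is_center J (v 1%N)).
Context (hz : forall t, (1 <= t <= T)%N -> is_prox J (v t)
  ((gammaT OmX GX LX m T * theta R T t) *: Fop f gx (u t) (v t)) (z t)).
Context (hv : forall t, (1 <= t <= T)%N -> is_prox J (v t)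
  ((gammaT OmX GX LX m T * theta R T t) *: Fop f gx (u t) (z t)) (v t.+1)).

Local Notation g := (gammaT OmX GX LX m T).

(** The mirror-prox steps telescope to the width of the joint setup; the step
    size is admissible because [gamma * theta_t <= 1 / L]. *)
Lemma operator_regret w : pdom J w ->
  \sum_(1 <= t < T.+1) theta R T t * dotp (Fop f gx (u t) (z t)) (z t - w)
    <= L * (2 / T.+1%:R).
Proof.
move=> Jw; have rJ := joint_setup_regular.
have Zv t : (t < T.+1)%N -> pdomo J (v t.+1).
  case: t => [_|t tT]; first exact: is_center_pdomo hv1.
  by apply: is_prox_pdomo; apply: hv.
have L2 : 0 < L * (2 / T.+1%:R) by rewrite mulr_gt0 ?LXY_gt0.
have gE : g = (L * (2 / T.+1%:R))^-1 by rewrite /gammaT sup_theta.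
have g0 : 0 < g by rewrite gE invr_gt0.
have step t : (t < T)%N ->
    g * (theta R T t.+1 * dotp (Fop f gx (u t.+1) (z t.+1)) (z t.+1 - w)) <=
    bregman J (v t.+1) w - bregman J (v t.+2) w.
  move=> tT; have tT' : (1 <= t.+1 <= T)%N by [].
  rewrite mulrA -dotpZl.
  apply: (mirror_prox_step rJ (Zv t (ltnW tT)) (hz tT') (hv tT')) => //.
  have [[Jv _] [Jz _]] := (Zv t (ltnW tT), hz tT').
  have [Jv' _] := hv tT'.
  have c0 : 0 < g * theta R T t.+1 by rewrite mulr_gt0// theta_gt0.
  have cL : g * theta R T t.+1 * L <= 1.
    have th := ler_wpM2l (ltW LXY_gt0) (@theta_le R _ _ tT T0).
    rewrite -(ler_pM2l L2) mulr1; apply: le_trans th.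
    by rewrite -mulrA gE mulVKf ?gt_eqF// mulrC.
  rewrite -scalerBr dotpZl.
  have sm := Fop_smooth (fun i => hu i tT') Jv Jz Jv'.
  apply: le_trans (ler_wpM2l (ltW c0) sm) _; rewrite [leLHS]mulrA.
  apply: ler_piMl => //.
  by rewrite divr_ge0// addr_ge0// sqr_ge0.
have sum (j : nat) : (j <= T)%N -> g * \sum_(1 <= t < j.+1)
    theta R T t * dotp (Fop f gx (u t) (z t)) (z t - w) <=
    bregman J (v 1%N) w - bregman J (v j.+1) w.
  elim: j => [_|j IH jT]; first by rewrite big_nil mulr0 subrr.
  rewrite big_nat_recr//= mulrDr; have := IH (ltnW jT); have := step j jT.
  lra.
have := sum T (leqnn T); have := joint_center_width hv1 Jw.
have := bregman_ge0 rJ (Zv T (ltnSn T)) Jw => h1 h2 h3.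
rewrite -(ler_pM2l g0); apply: (le_trans h3); rewrite gE mulVf ?gt_eqF//.
lra.
Qed.

(** The regret against the vertex [e_i] of the simplex: the x-part of the
    operator is bounded below by convexity of the payoffs, and the y-part is
    linear. *)
Lemma saddle_gap x i : pdom PX x ->
  \sum_(1 <= t < T.+1) theta R T t * f i (lsubmx (z t)) (u t i) <=
  \sum_(1 <= t < T.+1)
    theta R T t * (\sum_j rsubmx (z t) 0 j * f j x (u t j)) + L * (2 / T.+1%:R).
Proof.
move=> Xx.
have Ye : pdom Y (delta_mx 0 i).
  split=> [j|]; first by rewrite mxE/=; case: (j == i).
  rewrite (bigD1 i)//= mxE !eqxx big1 ?addr0// => j ji.
  by rewrite mxE (negbTE ji) andbF.
have Jw : pdom J (row_mx x (delta_mx 0 i)).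
  by split; rewrite ?row_mxKl ?row_mxKr.
apply: le_trans (lerD (lexx _) (operator_regret Jw)).
rewrite -big_split/= !big_nat; apply: ler_sum => t; rewrite ltnS => tT.
rewrite -mulrDr ler_wpM2l//; first by apply/ltW/theta_gt0 => //; case/andP: tT.
have [[Xz Yz] _] := hz tT.
rewrite dotp_row_mx lsubmxB rsubmxB /Fop !row_mxKl !row_mxKr.
have -> : dotp (- \row_j f j (lsubmx (z t)) (u t j))
    (rsubmx (z t) - delta_mx 0 i) =
    f i (lsubmx (z t)) (u t i)
    - \sum_j rsubmx (z t) 0 j * f j (lsubmx (z t)) (u t j).
  rewrite dotpNl dotpBr !dotpE opprB; congr (_ - _).
    rewrite (bigD1 i)//= !mxE !eqxx mulr1 big1 ?addr0// => j ji.
    by rewrite !mxE (negbTE ji) andbF mulr0.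
  by apply: eq_bigr => j _; rewrite mxE mulrC.
rewrite dotp_suml [leRHS]addrA [leRHS]addrCA lerDl -big_split/= -sumrB.
apply: sumr_ge0 => j _.
case: Yz => y0 _; have := hgx Xz (hu j tT) Xx.
rewrite dotpZl -mulrDr -mulrBr => hj; apply: mulr_ge0; first exact: y0.
move: hj; rewrite !dotp_lin; lra.
Qed.

End SaddlePoint.

(** * Correctness of the decision rule *)
Lemma inf_range_fin_gt0 (R : realType) (m : nat) (a : 'I_m -> R) :
  (0 < m)%N -> (forall i, 0 < a i) ->
  0 < inf (range a) /\ forall i, inf (range a) <= a i.
Proof.
case: m a => // m a _ a0; split.
  case: (arg_minP a (erefl true : xpredT ord0)) => i _ hi.
  apply: lt_le_trans (a0 i) _; apply: lb_le_inf; first by exists (a i), i.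
  by move=> _ [j _ <-]; exact: hi.
move=> i; apply: ge_inf; last by exists i.
by exists 0 => _ [j _ <-]; exact: ltW.
Qed.

Lemma sup_range_fin_le (R : realType) (m : nat) (F : 'I_m -> R) c :
  (0 < m)%N -> (sup (range F) <= c <-> forall i, F i <= c).
Proof.
case: m F => // m F _; split=> [h i|h].
  apply: le_trans h; apply: ub_le_sup; last by exists i.
  exists (\sum_j `|F j|) => _ [j _ <-].
  by rewrite (bigD1 j)//= (le_trans (ler_norm _))// lerDl sumr_ge0.
apply: ge_sup; first by exists (F ord0), ord0.
by move=> _ [i _ <-].
Qed.

Lemma width_neq (R : realType) (n : nat) (P : prox_data R n) Om :
  is_width P Om -> 0 < Om ->
  exists z z', [/\ pdom P z, pdom P z' & z != z'].
Proof.
move=> [zc [[Zc _] _ [z Zz Vz]]] Om0; exists z, zc; split => //.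
apply/eqP => zE; move: Om0; rewrite -Vz zE /bregman !subrr dotp0r subr0.
by rewrite ltxx.
Qed.

(** The term [LX * OmX] is absorbed by [sqrt (ln m)] because [m >= 2]. *)
Lemma LXY_le_sqrt_ln (R : realType) (OmX GX LX : R) (m : nat) : (2 <= m)%N ->
  0 <= OmX -> 0 <= LX ->
  LXY OmX GX LX m <=
    (LX * OmX / Num.sqrt (ln 2) + 2 * GX * Num.sqrt OmX) * Num.sqrt (ln m%:R).
Proof.
move=> m2 Om0 LX0.
have l2 : 0 < ln 2 :> R by rewrite ln_gt0// ltr1n.
have s2 : 0 < Num.sqrt (ln 2) :> R by rewrite sqrtr_gt0.
have sm : Num.sqrt (ln 2) <= Num.sqrt (ln m%:R) :> R.
  by rewrite ler_wsqrtr// ler_ln ?posrE ?ltr0n ?ler_nat// (leq_trans _ m2).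
have h : LX * OmX <= LX * OmX / Num.sqrt (ln 2) * Num.sqrt (ln m%:R).
  rewrite mulrAC ler_pdivlMr//.
  by apply: ler_wpM2l => //; rewrite mulr_ge0.
rewrite /LXY sqrtrM// mulrDl; lra.
Qed.

Theorem theorem8 (R : realType) (OmX GX LX OmU GU alphaU tau : R)
    (OmX_gt0 : 0 < OmX) (GX_gt0 : 0 < GX) (tau_01 : 0 < tau < 1) :
  exists2 C : R, 0 < C &
  forall (m n : nat) (k : 'I_m -> nat)
    (PX : prox_data R n) (PU : forall i : 'I_m, prox_data R (k i))
    (f : forall i : 'I_m, 'rV[R]_n -> 'rV[R]_(k i) -> R)
    (gx : forall i : 'I_m, 'rV[R]_n -> 'rV[R]_(k i) -> 'rV[R]_n)
    (gu : forall i : 'I_m, 'rV[R]_n -> 'rV[R]_(k i) -> 'rV[R]_(k i))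
    (alpha : 'I_m -> R),
  (2 <= m)%N ->
  proximal_setup PX ->
  is_width PX OmX ->
  (forall i, proximal_setup (PU i)) ->
  (forall i, exists2 w, is_width (PU i) w & w <= OmU) ->
  (forall i ui, pdom (PU i) ui -> convex_function (pdom PX) (f i ^~ ui)) ->
  (forall i x, pdom PX x ->
     convex_function (pdom (PU i)) (fun ui => - f i x ui)) ->
  (forall i x ui, pdom PX x -> pdom (PU i) ui ->
     is_subgradient (pdom PX) (f i ^~ ui) x (gx i x ui)) ->
  (forall i x ui, pdom PX x -> pdom (PU i) ui ->
     is_supergradient (pdom (PU i)) (f i x) ui (gu i x ui)) ->
  (forall i x ui, pdom PX x -> pdom (PU i) ui ->
     dual_norm (pnorm PX) (gx i x ui) <= GX) ->
  (forall i x ui, pdom PX x -> pdom (PU i) ui ->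
     dual_norm (pnorm (PU i)) (gu i x ui) <= GU) ->
  (forall i, 0 < alpha i) ->
  (forall i x, pdom PX x ->
     convex_function (pdom (PU i))
       (fun ui => - f i x ui - alpha i * dgf (PU i) ui)) ->
  alphaU = inf (range alpha) ->
  (forall i ui x x', pdom (PU i) ui -> pdom PX x -> pdom PX x' ->
     dual_norm (pnorm PX) (gx i x ui - gx i x' ui) <= LX * pnorm PX (x - x')) ->
  forall (eps : R) (T : nat) (u : nat -> forall i : 'I_m, 'rV[R]_(k i))
    (v z : nat -> 'rV[R]_(n + m)),
  0 < eps ->
  C * Num.sqrt (ln m%:R) / eps <= T%:R ->
  iterations OmX GX LX alphaU PX PU f gx gu T u v z ->
  decision_correct (pdom PX) (fun i => pdom (PU i)) f tau eps T
    (fun t => lsubmx (z t)) u.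
Proof.
have /andP[tau0 tau1] := tau_01.
have l2 : 0 < ln 2 :> R by rewrite ln_gt0// ltr1n.
pose s2 : R := Num.sqrt (ln 2).
have s2_gt0 : 0 < s2 by rewrite sqrtr_gt0.
(* [C1] makes the duality gap at most [(1 - tau) * eps] and [C2] the regret at
   most [tau * eps]; the summand 1 forces [0 < T].  The absolute values keep
   both nonnegative for all [LX] and [alphaU]. *)
pose C1 := 2 * (`|LX| * OmX / s2 + 2 * GX * Num.sqrt OmX) / (1 - tau).
pose C2 := 2 * GU ^+ 2 / (`|alphaU| * tau * s2).
have tau1' : 0 < 1 - tau by lra.
have C1_ge0 : 0 <= C1.
  apply: divr_ge0; last exact: ltW.
  apply: mulr_ge0 => //; apply: addr_ge0.
    by apply: divr_ge0; [rewrite mulr_ge0// ltW | exact: ltW].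
  by rewrite !mulr_ge0// ltW.
have C2_ge0 : 0 <= C2.
  apply: divr_ge0; first by rewrite mulr_ge0// sqr_ge0.
  by rewrite !mulr_ge0// ltW.
exists (C1 + C2 + 1); first by lra.
move=> m n k PX PU f gx gu alpha m2 sX wX sU wU cvf cvU hgx hgu hGX hGU.
move=> alpha0 hsc alphaE hLX eps T u v z eps0 hT [hu1 hu hv1 hz hv].
have m0 : (0 < m)%N by exact: leq_trans m2.
have [] := inf_range_fin_gt0 m0 alpha0; rewrite -alphaE => aU0 aU_le.
pose sm : R := Num.sqrt (ln m%:R).
have s2sm : s2 <= sm.
  by rewrite ler_wsqrtr// ler_ln ?posrE ?ltr0n ?ler_nat.
have sm_gt0 : 0 < sm by exact: lt_le_trans s2sm.
have T0 : (0 < T)%N.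
  rewrite -(ltr_nat R); apply: lt_le_trans hT.
  by rewrite divr_gt0// mulr_gt0//; lra.
(* The dual norm is nonnegative, and [X] contains two points because its width
   is positive. *)
have LX0 : 0 <= LX.
  have [x [x' [Xx Xx' xx']]] := width_neq wX OmX_gt0.
  pose i := Ordinal m0; have [c [Uc _]] := setup_center (sU i).
  have hN := setup_norm sX.
  have N0 : 0 < pnorm PX (x - x').
    rewrite lt_neqAle is_norm_ge0// andbT eq_sym; apply/eqP => /(is_norm_eq0 hN).
    by move/eqP; rewrite subr_eq0 (negbTE xx').
  rewrite -(pmulr_lge0 _ N0); apply: le_trans (hLX i c x x' Uc Xx Xx').
  exact: dual_norm_ge0.
have Jz t : (1 <= t <= T)%N -> pdom PX (lsubmx (z t)).
  by move=> /hz[[]].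
have Uu t i : (1 <= t <= T)%N -> pdom (PU i) (u t i).
  case: t => // -[_|t /andP[_ tT]]; first by have [] := hu1 i.
  by have [] := hu t.+1 i (ltnW tT).
have T1 : T%:R <= T.+1%:R :> R by rewrite ler_nat.
have T10 : 0 < T.+1%:R :> R by rewrite ltr0n.
have {}hT : (C1 + C2 + 1) * sm <= eps * T.+1%:R.
  by rewrite (mulrC eps) -ler_pdivrMr//; exact: le_trans hT T1.
have C2sm : 0 <= C2 * sm by rewrite mulr_ge0// ltW.
have C1sm : 0 <= C1 * sm by rewrite mulr_ge0// ltW.
have gap_small : LXY OmX GX LX m * (2 / T.+1%:R) <= (1 - tau) * eps.
  have hL := LXY_le_sqrt_ln GX m2 (ltW OmX_gt0) LX0.
  have C1E : (1 - tau) * (C1 * sm) = 2 * ((LX * OmX / s2 +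
      2 * GX * Num.sqrt OmX) * sm).
    by rewrite /C1 ger0_norm//; field; rewrite !gt_eqF.
  have : (1 - tau) * (C1 * sm) <= (1 - tau) * (eps * T.+1%:R).
    by apply: ler_wpM2l; [exact: ltW | lra].
  rewrite C1E => h; rewrite mulrA ler_pdivrMr//.
  rewrite -/s2 -/sm in hL; lra.
have regret_small : 2 * GU ^+ 2 / (alphaU * T.+1%:R) <= tau * eps.
  have C2E : alphaU * tau * (C2 * s2) = 2 * GU ^+ 2.
    by rewrite /C2 gtr0_norm//; field; rewrite !gt_eqF.
  have C2s : C2 * s2 <= eps * T.+1%:R.
    by have := ler_wpM2l C2_ge0 s2sm; lra.
  have at0 : 0 <= alphaU * tau by rewrite mulr_ge0// ltW.
  have := ler_wpM2l at0 C2s; rewrite C2E ler_pdivrMr ?mulr_gt0//; lra.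
have sum1 := @sum_theta R T T0.
rewrite /decision_correct; case: ifPn => [/(sup_range_fin_le _ _ m0) hle|].
- have jensen h : convex_function (pdom PX) h ->
      pdom PX (\sum_(1 <= t < T.+1) theta R T t *: lsubmx (z t)) /\
      h (\sum_(1 <= t < T.+1) theta R T t *: lsubmx (z t)) <=
      \sum_(1 <= t < T.+1) theta R T t * h (lsubmx (z t)).
    move=> ch; have := @jensen_nat R n (pdom PX) h (theta R T)
      (fun t => lsubmx (z t)) T.-1 (setup_convex sX) ch.
    rewrite prednK// => /(_ _)[t /andP[t1 tT]|_].
      by split; [exact: theta_gt0 | apply: Jz; rewrite t1].
    by rewrite sum1 invr1 scale1r mul1r.
  split.
    pose i := Ordinal m0; have [c [Uc _]] := setup_center (sU i).
    by have [] := jensen _ (cvf i c Uc).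
  move=> i; apply: ge_ereal_sup => _ [w Uw <-]; rewrite lee_fin.
  have [_ hJ] := jensen _ (cvf i w Uw); apply: le_trans hJ _.
  have reg : \sum_(1 <= t < T.+1) theta R T t *
      (f i (lsubmx (z t)) w - f i (lsubmx (z t)) (u t i)) <=
      2 * GU ^+ 2 / (alphaU * T.+1%:R).
    apply: (strongly_concave_regret (sU i) aU0 (aU_le i) (hu1 i) T0
      (phi := fun t => f i (lsubmx (z t)))
      (g := fun t => gu i (lsubmx (z t)) (u t i)) (u := fun t => u t i)) => //.
    move=> t tT Uut; have Xz := Jz t tT.
    by split; [exact: hsc | exact: hgu | exact: hGU | exact: hu].
  have := hle i; move: reg.
  under eq_bigr => t _ do rewrite mulrBr.
  rewrite sumrB lerBlDr => reg hi; apply: le_trans reg _.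
  apply: le_trans (lerD regret_small hi) _; lra.
- move=> hgt x Xx.
  have [i hi] : exists i, (1 - tau) * eps <
      \sum_(1 <= t < T.+1) theta R T t * f i (lsubmx (z t)) (u t i).
    apply: contrapT => hno; move/negP: hgt; apply.
    apply/(sup_range_fin_le _ _ m0) => i; rewrite leNgt; apply/negP => hi.
    by apply: hno; exists i.
  apply: contrapT => hno.
  have fle j t : (1 <= t <= T)%N -> f j x (u t j) <= 0.
    move=> tT; rewrite -lee_fin; apply: (@le_trans _ _ _ _ _
      (ereal_sup_ubound (_ : [set (f j x ui)%:E | ui in pdom (PU j)] _))).
      by exists (u t j) => //; exact: Uu.
    by rewrite leNgt; apply/negP => ?; apply: hno; exists j.
  have := saddle_gap OmX_gt0 GX_gt0 LX0 m2 sX wX hgx hGX hLX T0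
    (fun t i tT => Uu t i tT) hv1 hz hv i Xx.
  have : \sum_(1 <= t < T.+1) theta R T t *
      (\sum_j rsubmx (z t) 0 j * f j x (u t j)) <= 0.
    rewrite big_nat; apply: sumr_le0 => t; rewrite ltnS => tT.
    apply: mulr_ge0_le0; first by apply/ltW/theta_gt0 => //; case/andP: tT.
    apply: sumr_le0 => j _; apply: mulr_ge0_le0; last exact: fle.
    by have [[_ [y0 _]] _] := hz t tT.
  move=> hle0 hgap.
  have := lt_le_trans hi (le_trans hgap (lerD hle0 gap_small)).
  by rewrite add0r ltxx.
Qed.
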